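(* Let $X$ be a stratifiable $k$-space. Then the following are equivalent: (1) $F_{8}(X)$ has countable tightness; (2) $F(X)$ has countable tightness; (3) $X$ is separable or discrete. *)

(* Defs.v *)
From Stdlib Require Import List ClassicalEpsilon.
Import ListNotations.
Set Implicit Arguments.

Section Top.
Variable T : Type.

Definition is_topology (op : (T -> Prop) -> Prop) : Prop :=
  op (fun _ => True) /\
  (forall U V, op U -> op V -> op (fun x => U x /\ V x)) /\
  (forall F : (T -> Prop) -> Prop, (forall U, F U -> op U) ->
      op (fun x => exists U, F U /\ U x)).

Definition closure (op : (T -> Prop) -> Prop) (A : T -> Prop) (x : T) : Prop :=
  forall U, op U -> U x -> exists y, U y /\ A y.

Definition closed (op : (T -> Prop) -> Prop) (A : T -> Prop) : Prop :=
  op (fun x => ~ A x).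

Definition countable (B : T -> Prop) : Prop :=
  exists f : nat -> T, forall y, B y -> exists n, f n = y.

(* countable tightness of the subspace Y (closure in Y of A ⊆ Y is closure A ∩ Y) *)
Definition countable_tightness_on (op : (T -> Prop) -> Prop) (Y : T -> Prop) : Prop :=
  forall (A : T -> Prop) (y : T), (forall z, A z -> Y z) -> Y y -> closure op A y ->
    exists B : T -> Prop, (forall z, B z -> A z) /\ countable B /\ closure op B y.

Definition countable_tightness (op : (T -> Prop) -> Prop) : Prop :=
  countable_tightness_on op (fun _ => True).

Definition separable (op : (T -> Prop) -> Prop) : Prop :=
  exists D : T -> Prop, countable D /\ forall x, closure op D x.

Definition discrete (op : (T -> Prop) -> Prop) : Prop := forall U, op U.

Definition compact_set (op : (T -> Prop) -> Prop) (K : T -> Prop) : Prop :=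
  forall C : (T -> Prop) -> Prop, (forall U, C U -> op U) ->
    (forall x, K x -> exists U, C U /\ U x) ->
    exists l : list (T -> Prop), (forall U, In U l -> C U) /\
      (forall x, K x -> exists U, In U l /\ U x).

Definition closed_in (op : (T -> Prop) -> Prop) (K S : T -> Prop) : Prop :=
  exists C, closed op C /\ forall x, K x -> (S x <-> C x).

Definition k_space (op : (T -> Prop) -> Prop) : Prop :=
  forall A : T -> Prop,
    (forall K, compact_set op K -> closed_in op K (fun x => A x /\ K x)) ->
    closed op A.

Definition T1 (op : (T -> Prop) -> Prop) : Prop :=
  forall x y : T, x <> y -> exists U, op U /\ U x /\ ~ U y.

Definition stratifiable (op : (T -> Prop) -> Prop) : Prop :=
  T1 op /\
  exists G : nat -> (T -> Prop) -> (T -> Prop),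
    (forall n U, op U -> op (G n U)) /\
    (forall n U, op U -> forall x, closure op (G n U) x -> U x) /\
    (forall U, op U -> forall x, U x <-> exists n, G n U x) /\
    (forall n U V, op U -> op V -> (forall x, U x -> V x) ->
        forall x, G n U x -> G n V x).

Definition generated_topology (S : (T -> Prop) -> Prop) (O : T -> Prop) : Prop :=
  forall op' : (T -> Prop) -> Prop, is_topology op' ->
    (forall U, S U -> op' U) -> op' O.
End Top.

Section FreeGroup.
Variable X : Type.

Definition letter := (X * bool)%type.   (* (x,true) = x, (x,false) = x^-1 *)

Definition inv_letters (a b : letter) : Prop := fst a = fst b /\ snd a <> snd b.

Fixpoint reduced (w : list letter) : Prop :=
  match w with
  | [] => True
  | a :: w' => (match w' with [] => True | b :: _ => ~ inv_letters a b end)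
               /\ reduced w'
  end.

Definition push (a : letter) (w : list letter) : list letter :=
  match w with
  | [] => [a]
  | b :: w' => if excluded_middle_informative (inv_letters a b) then w' else a :: w
  end.

Definition reduce (w : list letter) : list letter := fold_right push [] w.

Lemma reduced_tail a w : reduced (a :: w) -> reduced w.
Proof. simpl; tauto. Qed.

Lemma push_reduced a w : reduced w -> reduced (push a w).
Proof.
  destruct w as [|b w']; simpl; [tauto|].
  intros H. destruct (excluded_middle_informative (inv_letters a b)).
  - tauto.
  - simpl. tauto.
Qed.

Lemma reduce_reduced w : reduced (reduce w).
Proof. induction w; simpl; [exact I|]. now apply push_reduced. Qed.

Definition FA : Type := { w : list letter | reduced w }.

Definition word (g : FA) : list letter := proj1_sig g.

Definition FA_of (w : list letter) : FA := exist _ (reduce w) (reduce_reduced w).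

Definition FA_mul (g h : FA) : FA := FA_of (word g ++ word h).

Definition FA_inv (g : FA) : FA :=
  FA_of (rev (map (fun a : letter => (fst a, negb (snd a))) (word g))).

Lemma reduced_single (a : letter) : reduced [a].
Proof. simpl; tauto. Qed.

Definition eta (x : X) : FA := exist _ [(x, true)] (reduced_single (x, true)).

Definition Fn (n : nat) (g : FA) : Prop := length (word g) <= n.

Definition is_group_topology (tau : (FA -> Prop) -> Prop) : Prop :=
  is_topology tau /\
  forall (g h : FA) (O : FA -> Prop), tau O -> O (FA_mul g (FA_inv h)) ->
    exists U V, tau U /\ tau V /\ U g /\ V h /\
      forall g' h', U g' -> V h' -> O (FA_mul g' (FA_inv h')).

Definition continuous_into (opX : (X -> Prop) -> Prop) (tau : (FA -> Prop) -> Prop)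
  (f : X -> FA) : Prop :=
  forall O, tau O -> opX (fun x => O (f x)).

(* Markov free topological group F(X): the finest group topology on F_a(X)
   making eta continuous, i.e. the topology generated by all such topologies. *)
Definition free_top (opX : (X -> Prop) -> Prop) : (FA -> Prop) -> Prop :=
  generated_topology (fun U => exists tau, is_group_topology tau /\
                                continuous_into opX tau eta /\ tau U).
End FreeGroup.

(* Main.v *)
(* A stratifiable space carries a neighbourhood assignment g(n, x) such that every
   neighbourhood W of p contains all x for which g(n, x) meets a suitable
   neighbourhood N of p, for some n. If some g(n, -) has no countable subcover of a
   set Y, a well-ordering of the space yields an uncountable subset of Y that is
   locally finite in Y; otherwise Y is separable. Hence separable stratifiable
   spaces are hereditarily separable. This applies to the space of words over X,
   which maps continuously onto F(X), so F(X) is countably tight.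

   If X is neither separable nor discrete, it contains an uncountable closed
   discrete set D and a sequence x_n -> p with x_n <> p. Take e : D * D -> nat such
   that every f : D -> nat satisfies f(a), f(b) <= e(a, b) for some a, b. Then 1
   lies in the closure of the words a x_n p^-1 a^-1 b x_n p^-1 b^-1 with n = e(a, b).
   Given countably many of these words, X maps continuously to the group of affine
   maps of the line, x_n p^-1 becoming a translation by t_n > 0 and the letters d
   involved becoming dilations by factors so large that every given word becomes a
   translation by at least 1; so they do not accumulate at 1. *)
From Stdlib Require Import ZArith Reals Lra.
From Coquelicot Require Import Coquelicot.
From Stdlib Require Import List Classical ClassicalEpsilon FunctionalExtensionality PropExtensionality.
From Stdlib Require Import ProofIrrelevance Arith Lia Cantor.
From mathcomp Require eqtype boolp wochoice.
Require Import Defs.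
Import ListNotations.
Open Scope nat_scope.

(** * Countable sets *)

Section WellOrder.
Import mathcomp.boot.eqtype mathcomp.classical.boolp.
(** MathComp supplies a boolean relation for which every nonempty set has a unique least element.
    Two-point sets yield totality and antisymmetry, three-point sets transitivity; removing the
    diagonal makes the order strict. *)
Lemma well_order (T : Type) : exists lt : T -> T -> Prop,
  (forall x, ~ lt x x) /\ (forall x y z, lt x y -> lt y z -> lt x z) /\
  (forall x y, lt x y \/ x = y \/ lt y x) /\
  (forall P : T -> Prop, (exists x, P x) -> exists x, P x /\ forall y, P y -> ~ lt y x).
Proof.
  destruct (wochoice.well_ordering_principle _ :
    {R : ssrbool.rel (boolp.classicType T) | wochoice.well_order R}) as [R HR].
  change (ssrbool.rel T) in R.
  assert (Hmin : forall P : T -> Prop, (exists x, P x) ->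
    exists x, P x /\ (forall y, P y -> R x y = true) /\
      forall z, P z -> (forall y, P y -> R z y = true) -> z = x).
  { intros P [x Px].
    destruct (HR (fun x => boolp.asbool (P x))) as [z [[Pz Hz] Uz]].
    - exists x. unfold ssrbool.in_mem; simpl. now apply boolp.asboolT.
    - exists z. split; [|split].
      + now apply boolp.asboolW.
      + intros y Py. apply Hz. now apply boolp.asboolT.
      + intros y Py Hy. symmetry. apply Uz. split.
        * now apply boolp.asboolT.
        * intros t Pt. apply Hy. now apply boolp.asboolW. }
  assert (Htot : forall x y, R x y = true \/ R y x = true).
  { intros x y. destruct (Hmin (fun z => z = x \/ z = y)) as [z [[->| ->] [Hz _]]]; eauto. }
  assert (Hanti : forall x y, R x y = true -> R y x = true -> x = y).
  { intros x y H1 H2. destruct (Hmin (fun z => z = x \/ z = y)) as [z [Pz [Hz Uz]]]; eauto.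
    assert (Hxx : forall t, R t t = true) by (intros t; destruct (Htot t t); auto).
    transitivity z; [|symmetry]; apply Uz; auto; intros t [->| ->]; auto. }
  assert (Htr : forall x y z, R x y = true -> R y z = true -> R x z = true).
  { intros x y z H1 H2.
    destruct (Hmin (fun t => t = x \/ t = y \/ t = z)) as [t [Pt [Ht _]]]; eauto.
    destruct Pt as [-> | [-> | ->]].
    - auto.
    - assert (E : x = y) by (apply Hanti; auto). now subst.
    - assert (E : z = y) by (apply Hanti; auto). now subst. }
  exists (fun x y => R x y = true /\ x <> y).
  split; [|split; [|split]].
  - intros x [_ H]. now apply H.
  - intros x y z [H1 H2] [H3 H4]. split; [eauto|].
    intros E; subst z. auto.
  - intros x y. destruct (EM (x = y)) as [H|H]; auto.
    destruct (Htot x y); auto.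
  - intros P HP. destruct (Hmin P HP) as [x [Px [Hx _]]]. exists x; split; auto.
    intros y Py [H1 H2]. apply H2. apply Hanti; auto.
Qed.
End WellOrder.

Lemma choice {A B : Type} (R : A -> B -> Prop) :
  (forall x, exists y, R x y) -> exists f, forall x, R x (f x).
Proof.
  intros H. exists (fun x => proj1_sig (constructive_indefinite_description _ (H x))).
  intros x. now destruct constructive_indefinite_description.
Qed.

(* Unlike [countable], this makes the empty subset of the empty type countable. *)
Definition cnt {T : Type} (P : T -> Prop) : Prop :=
  exists h : T -> nat, forall x y, P x -> P y -> h x = h y -> x = y.

Lemma cnt_sub {T : Type} (P Q : T -> Prop) : (forall x, Q x -> P x) -> cnt P -> cnt Q.
Proof. intros H [h Hh]. exists h. auto. Qed.

Lemma countable_cnt {T : Type} (P : T -> Prop) : countable P -> cnt P.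
Proof.
  intros [f Hf].
  destruct (choice (fun (x : T) n => P x -> f n = x)) as [h Hh].
  - intros x. destruct (classic (P x)) as [Px|Px].
    + destruct (Hf x Px) as [n Hn]; eauto.
    + exists 0. tauto.
  - exists h. intros x y Px Py E. rewrite <- (Hh x Px), <- (Hh y Py). now f_equal.
Qed.

Lemma cnt_countable {T : Type} (t0 : T) (P : T -> Prop) : cnt P -> countable P.
Proof.
  intros [h Hh].
  destruct (choice (fun n (x : T) => forall y, P y -> h y = n -> x = y)) as [f Hf].
  - intros n. destruct (classic (exists y, P y /\ h y = n)) as [[y [Py Hy]]|H].
    + exists y. intros z Pz Hz. apply Hh; congruence.
    + exists t0. intros y Py Hy. exfalso; eauto.
  - exists f. intros y Py. exists (h y). auto.
Qed.

Lemma cnt_image {S T : Type} (f : S -> T) (P : S -> Prop) :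
  cnt P -> cnt (fun y => exists x, P x /\ f x = y).
Proof.
  intros [h Hh].
  destruct (choice (fun (y : T) n => forall x, P x -> f x = y ->
     exists x', P x' /\ f x' = y /\ h x' = n)) as [k Hk].
  - intros y. destruct (classic (exists x, P x /\ f x = y)) as [[x [Px Hx]]|H].
    + exists (h x). intros. eauto.
    + exists 0. intros x Px Hx. exfalso; eauto.
  - exists k. intros y1 y2 [x1 [P1 E1]] [x2 [P2 E2]] E.
    destruct (Hk y1 x1 P1 E1) as [z1 [Q1 [F1 G1]]].
    destruct (Hk y2 x2 P2 E2) as [z2 [Q2 [F2 G2]]].
    assert (z1 = z2) by (apply Hh; congruence). congruence.
Qed.

Lemma to_nat_inj p q : to_nat p = to_nat q -> p = q.
Proof. intros E. rewrite <- (cancel_of_to p), <- (cancel_of_to q). now f_equal. Qed.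

Lemma cnt_union {T : Type} (P : nat -> T -> Prop) :
  (forall n, cnt (P n)) -> cnt (fun x => exists n, P n x).
Proof.
  intros H. destruct (choice _ H) as [h Hh].
  destruct (choice (fun (x : T) n => (exists n, P n x) -> P n x)) as [m Hm].
  - intros x. destruct (classic (exists n, P n x)) as [[n Hn]|H']; eauto.
    exists 0. tauto.
  - exists (fun x => to_nat (m x, h (m x) x)). intros x y Px Py E.
    apply to_nat_inj in E. injection E as E1 E2.
    apply Hm in Px, Py. rewrite <- E1 in *. eauto.
Qed.

Lemma cnt_or {T : Type} (P Q : T -> Prop) : cnt P -> cnt Q -> cnt (fun x => P x \/ Q x).
Proof.
  intros HP HQ.
  apply cnt_sub with (P := fun x => exists n : nat, match n with 0 => P x | S _ => Q x end).
  - intros x [H|H]; [exists 0|exists 1]; auto.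
  - apply cnt_union. intros [|n]; assumption.
Qed.

Lemma cnt_In {T : Type} (l : list T) : cnt (fun x => In x l).
Proof.
  induction l as [|a l IH].
  - exists (fun _ => 0). simpl; tauto.
  - apply cnt_or; auto. exists (fun _ => 0). intros; congruence.
Qed.

Lemma cnt_letters {T : Type} (P : T -> Prop) :
  cnt P -> cnt (fun l : T * bool => P (fst l)).
Proof.
  intros [h Hh]. exists (fun l : T * bool => to_nat (h (fst l), if snd l then 1 else 0)).
  intros [x b] [y c] Px Py E. apply to_nat_inj in E. injection E as E1 E2. simpl in *.
  f_equal; auto. destruct b, c; congruence.
Qed.

Lemma cnt_list {T : Type} (P : T -> Prop) : cnt P -> cnt (Forall P).
Proof.
  intros [h Hh].
  exists (fold_right (fun (x : T) (n : nat) => S (to_nat (h x, n))) 0).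
  intros l. induction l as [|x l IH]; intros [|y l']; cbn [fold_right]; try discriminate; auto.
  intros H H' E. apply eq_add_S, to_nat_inj in E. injection E as E1 E2.
  inversion H; inversion H'; subst. f_equal; auto.
Qed.

Lemma uncountable_outside {T : Type} (P Q : T -> Prop) :
  ~ cnt P -> cnt Q -> exists x, P x /\ ~ Q x.
Proof.
  intros HP HQ. destruct (classic (exists x, P x /\ ~ Q x)) as [|H]; auto.
  exfalso. apply HP. apply cnt_sub with Q; auto.
  intros x Px. destruct (classic (Q x)); auto. exfalso; eauto.
Qed.

Lemma uncountable_fiber {T : Type} (P : T -> Prop) (f : T -> nat) :
  ~ cnt P -> exists n, ~ cnt (fun x => P x /\ f x = n).
Proof.
  intros HP. apply not_all_ex_not. intros H. apply HP.
  apply cnt_union in H. revert H. apply cnt_sub. eauto.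
Qed.

(* The witness is [e(-, b)] injective on the predecessors of [b], for an
   ordering of type omega_1 of a subset of [R]. *)
Lemma uncountable_coloring {T : Type} (R : T -> Prop) : ~ cnt R ->
  exists e : T -> T -> nat, forall f : T -> nat,
    exists a b, R a /\ R b /\ f a <= e a b /\ f b <= e a b.
Proof.
  intros HR. destruct (well_order T) as [lt [irr [tr [tot wf]]]].
  assert (exists P : T -> Prop, ~ cnt P /\ (forall x, P x -> R x) /\
    forall b, P b -> cnt (fun a => P a /\ lt a b)) as [P [HP [HPR Hpred]]].
  (* If some point has uncountably many predecessors in [R], those of the least such point have
     countable initial segments; otherwise [R] itself does. *)
  { destruct (classic (exists b, ~ cnt (fun a => R a /\ lt a b))) as [H|H].
    - apply wf in H. destruct H as [b [Hb Hmin]].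
      exists (fun a => R a /\ lt a b). split; [auto|split; [tauto|]].
      intros c [Rc Lc]. destruct (classic (cnt (fun a => R a /\ lt a c))) as [H|H].
      + revert H. apply cnt_sub. tauto.
      + now apply Hmin in H.
    - exists R. repeat split; auto. intros b Rb.
      destruct (classic (cnt (fun a => R a /\ lt a b))); auto. exfalso; eauto. }
  destruct (choice (fun (b : T) (h : T -> nat) => P b -> forall x y,
     P x /\ lt x b -> P y /\ lt y b -> h x = h y -> x = y)) as [e He].
  { intros b. destruct (classic (P b)) as [Pb|Pb].
    - destruct (Hpred b Pb) as [h Hh]; eauto.
    - exists (fun _ => 0). tauto. }
  exists (fun a b => e b a). intros f.
  (* [f] takes one value [m] on an uncountable set [Q], so it suffices to find [a] below [b] in [Q]
     with [e b a] at least [m]. *)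
  destruct (uncountable_fiber P f HP) as [m Hm].
  set (Q := fun x => P x /\ f x = m) in *.
  destruct (classic (exists a b, Q a /\ Q b /\ lt a b /\ m <= e b a)) as
    [[a [b [[Pa Fa] [[Pb Fb] [_ Hab]]]]]|Hno].
  { exists a, b. subst m. rewrite Fb. auto. }
  exfalso.
  (* Otherwise take the first [k] points of [Q]. For [k = m + 1] and a further point [b] of [Q], the
     injective [e b] would map them into the [m] numbers below [m]. *)
  assert (Hl : forall k, exists l, length l = k /\ NoDup l /\ (forall x, In x l -> Q x) /\
     forall x y, Q x -> ~ In x l -> In y l -> lt y x).
  { induction k as [|k [l [Hl [Nl [Ql Il]]]]].
    - exists []. repeat split; simpl; try tauto. constructor.
    - destruct (wf (fun x => Q x /\ ~ In x l)) as [z [[Qz Nz] Hz]].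
      { apply uncountable_outside; auto using cnt_In. }
      exists (z :: l). split; [simpl; auto|split; [now constructor|split]].
      + intros x [<-|Hx]; auto.
      + intros x y Qx Nx [<-|Hy].
        * destruct (tot z x) as [|[->|H]]; auto.
          -- exfalso. apply Nx. now left.
          -- exfalso. apply (Hz x); auto. split; auto. intro; apply Nx; now right.
        * apply Il; auto. intro; apply Nx; now right. }
  destruct (Hl (S m)) as [l [Ll [Nl [Ql Il]]]].
  destruct (uncountable_outside Q (fun x => In x l) Hm (cnt_In l)) as [b [Qb Nb]].
  assert (HN : NoDup (map (e b) l)).
  { apply NoDup_map_NoDup_ForallPairs; auto. intros x y Hx Hy E.
    apply (He b); auto; try apply Qb; split; auto; apply (Ql _); auto. }
  assert (HI : incl (map (e b) l) (seq 0 m)).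
  { intros n Hn. apply in_map_iff in Hn. destruct Hn as [x [<- Hx]].
    apply in_seq. split; [lia|]. destruct (le_lt_dec m (e b x)); auto.
    exfalso. apply Hno. exists x, b. auto 6. }
  apply NoDup_incl_length in HI; auto. rewrite length_map, length_seq in HI. lia.
Qed.

(** * Stratifiable spaces *)

Section Topology.
Context {T : Type} {op : (T -> Prop) -> Prop}.
Hypothesis htop : is_topology op.

Lemma open_local (U : T -> Prop) :
  (forall x, U x -> exists V, op V /\ V x /\ forall y, V y -> U y) -> op U.
Proof.
  intros H. destruct htop as [_ [_ Hun]].
  replace U with (fun x => exists V, (op V /\ forall y, V y -> U y) /\ V x).
  - apply Hun. tauto.
  - apply functional_extensionality; intros x. apply propositional_extensionality.
    split; [intros [V [[_ HV] Vx]]; auto|]. intros Ux. destruct (H x Ux) as [V HV].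
    exists V. tauto.
Qed.

Lemma open_iff (U V : T -> Prop) : op U -> (forall x, U x <-> V x) -> op V.
Proof. intros HU H. apply open_local. intros x Vx. exists U. repeat split; auto; apply H; auto. Qed.

Lemma open_full : op (fun _ => True).
Proof. apply htop. Qed.

Lemma open_inter (U V : T -> Prop) : op U -> op V -> op (fun x => U x /\ V x).
Proof. apply htop. Qed.

Lemma open_forall_lt (V : nat -> T -> Prop) n :
  (forall i, op (V i)) -> op (fun x => forall i, i < n -> V i x).
Proof.
  intros H. induction n as [|n IH].
  - apply open_iff with (fun _ => True); [apply open_full|]. intros; split; auto. lia.
  - apply open_iff with (fun x => (forall i, i < n -> V i x) /\ V n x).
    + apply open_inter; auto.
    + intros x; split.
      * intros [H1 H2] i Hi. destruct (Nat.eq_dec i n) as [->|]; auto. apply H1; lia.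
      * intros H1; split; auto.
Qed.

Lemma not_closure (A : T -> Prop) x :
  ~ closure op A x -> exists U, op U /\ U x /\ forall y, U y -> ~ A y.
Proof.
  intros H. apply not_all_ex_not in H. destruct H as [U H]. exists U.
  destruct (classic (op U)); [|tauto]. destruct (classic (U x)); [|tauto].
  repeat split; auto. intros y Uy Ay. apply H. eauto.
Qed.

Lemma open_not_closure (A : T -> Prop) : op (fun x => ~ closure op A x).
Proof.
  apply open_local. intros x Hx. apply not_closure in Hx. destruct Hx as [U [HU [Ux H]]].
  exists U. repeat split; auto. intros y Uy Hy. destruct (Hy U HU Uy) as [z [Uz Az]].
  apply (H z); auto.
Qed.

Lemma subset_closure (A : T -> Prop) x : A x -> closure op A x.
Proof. intros Ax U _ Ux. eauto. Qed.

End Topology.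

(* Heath's neighbourhood-assignment form of stratifiability, which unlike the
   original definition passes immediately to products. *)
Definition stratifying {T : Type} (op : (T -> Prop) -> Prop) (g : nat -> T -> T -> Prop) : Prop :=
  (forall n x, op (g n x)) /\ (forall n x, g n x x) /\
  (forall n m x y, n <= m -> g m x y -> g n x y) /\
  (forall p W, op W -> W p -> exists n N, op N /\ N p /\
     forall x y, N y -> g n x y -> W x).

Lemma stratifiable_stratifying {T : Type} (op : (T -> Prop) -> Prop) :
  is_topology op -> stratifiable op -> exists g, stratifying op g.
Proof.
  intros htop [HT1 [G [Gop [Gcl [Gcov Gmon]]]]].
  assert (Hco : forall x, op (fun y => y <> x)).
  { intros x. apply (open_local htop). intros y Hy. destruct (HT1 y x Hy) as [U [HU [Uy Ux]]].
    exists U. repeat split; auto. intros z Uz ->. auto. }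
  (* [g n x] avoids the closures of the first [n + 1] sets that stratify the complement of [x];
     using all of them makes [g] decreasing in [n]. *)
  exists (fun n x y => forall i, i < S n -> ~ closure op (G i (fun z => z <> x)) y).
  split; [|split; [|split]].
  - intros n x. apply (open_forall_lt htop). intros i. apply (open_not_closure htop).
  - intros n x i _ H. now apply Gcl in H.
  - intros n m x y Hnm H i Hi. apply H. lia.
  (* If [x] lay outside [W], monotonicity would put [G n W] inside the set [G n] assigned to the
     complement of [x], which [g n x] avoids. *)
  - intros p W HW Wp. destruct (proj1 (Gcov W HW p) Wp) as [n Hn].
    exists n, (G n W). repeat split; auto. intros x y Ny Hy.
    apply NNPP. intros Wx. apply (Hy n); [lia|]. apply subset_closure.
    apply (Gmon n W); auto. intros z Wz ->. auto.
Qed.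

Section Stratified.
Context {T : Type} {op : (T -> Prop) -> Prop} {g : nat -> T -> T -> Prop}.
Hypothesis htop : is_topology op.
Hypothesis hg : stratifying op g.

Lemma stratifying_regular p W : op W -> W p ->
  exists N, op N /\ N p /\ forall x, closure op N x -> W x.
Proof.
  destruct hg as [gop [grefl [gdec gstr]]]. intros HW Wp.
  destruct (gstr p W HW Wp) as [n [N [HN [Np H]]]]. exists N. repeat split; auto.
  intros x Hx. destruct (Hx _ (gop n x) (grefl n x)) as [y [Hy Ny]]. eauto.
Qed.

(** [M] is the union of the intersections of [N] with [g n p], over [p] in the closure of [V] and
    pairs [n], [N] that witness the neighbourhood condition for [U] at [p]. *)
Lemma stratifying_normal (V U : T -> Prop) :
  op U -> (forall x, closure op V x -> U x) ->
  exists M, op M /\ (forall x, closure op V x -> M x) /\ (forall x, closure op M x -> U x).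
Proof.
  destruct hg as [gop [grefl [gdec gstr]]]. intros HU HVU.
  exists (fun y => exists p n N, closure op V p /\ op N /\ N p /\
     (forall x y, N y -> g n x y -> U x) /\ N y /\ g n p y).
  split; [|split].
  - apply (open_local htop). intros y [p [n [N [Vp [HN [Np [H [Ny Hy]]]]]]]].
    exists (fun z => N z /\ g n p z). split; [apply (open_inter htop); auto|].
    split; auto. intros z [Nz Hz]. exists p, n, N. auto 7.
  - intros p Vp. destruct (gstr p U HU (HVU p Vp)) as [n [N [HN [Np H]]]].
    exists p, n, N. auto 7.
  - intros q Hq. apply NNPP. intros Uq.
    assert (Vq : ~ closure op V q) by auto.
    destruct (gstr q _ (open_not_closure htop V) Vq) as [n' [N' [HN' [Nq' H']]]].
    destruct (Hq (fun z => N' z /\ g n' q z)) as [y [[Ny' Hy'] [p [n [N [Vp [HN [Np [H [Ny Hy]]]]]]]]]].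
    + apply (open_inter htop); auto.
    + auto.
    (* [y] lies in [N], [N'], [g n p] and [g n' q]. The smaller index decides: either [q] is forced
       into [U] or [p] out of the closure of [V]. *)
    + destruct (Nat.le_ge_cases n n') as [L|L].
      * apply Uq, (H q y); eauto.
      * apply (H' p y); eauto.
Qed.

(* Order the space well; the nonempty sets g n w minus all earlier g n v partition Y,
   and [rep] picks a point in each. *)
Lemma uncovered_discrete (Y : T -> Prop) n :
  ~ (exists E, cnt E /\ (forall x, E x -> Y x) /\ forall y, Y y -> exists x, E x /\ g n x y) ->
  exists R, ~ cnt R /\ (forall x, R x -> Y x) /\
    forall y, Y y -> exists V, op V /\ V y /\ forall r s, R r -> R s -> V r -> V s -> r = s.
Proof.
  destruct hg as [gop [grefl [gdec gstr]]]. intros Hno.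
  destruct (well_order T) as [lt [irr [tr [tot wf]]]].
  destruct (choice (fun y z => Y y -> Y z /\ g n z y /\ forall w, Y w -> g n w y -> ~ lt w z))
    as [z Hz].
  { intros y. destruct (classic (Y y)) as [Yy|Yy]; [|exists y; tauto].
    destruct (wf (fun w => Y w /\ g n w y)) as [w [[Yw Hw] Hmin]]; [eauto|].
    exists w. intros _. split; [auto|split; [auto|]]. intros v Yv Hv. apply Hmin; auto. }
  set (Im := fun w => exists y, Y y /\ z y = w).
  assert (HIm : ~ cnt Im).
  { intros H. apply Hno. exists Im. split; [auto|split].
    - intros w [y [Yy <-]]. now apply Hz.
    - intros y Yy. exists (z y). split; [exists y; auto|]. now apply Hz. }
  destruct (choice (fun w y => Im w -> Y y /\ z y = w)) as [rep Hrep].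
  { intros w. destruct (classic (Im w)) as [[y Hy]|H]; [eauto|exists w; tauto]. }
  set (O := fun w y => exists v, Y v /\ ~ lt w v /\ g n v y).
  assert (HO : forall w, op (O w)).
  { intros w. apply (open_local htop). intros y [v [Yv [Lv Hv]]].
    exists (g n v). repeat split; auto. intros t Ht. exists v; auto. }
  (* [m w] is an index at which the neighbourhood condition holds for [O w] at [rep w]; uncountably
     many [w] share one value [k]. *)
  destruct (choice (fun w m => Im w -> forall x, g m x (rep w) -> O w x)) as [m Hm].
  { intros w. destruct (classic (Im w)) as [H|H]; [|exists 0; tauto].
    destruct (Hrep w H) as [H1 H2]. destruct (Hz (rep w) H1) as [H3 [H4 H5]].
    destruct (gstr (rep w) (O w) (HO w)) as [k [N [HN [Np HN']]]].
    - exists w. rewrite H2 in *. auto.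
    - exists k. intros _ x Hx. eauto. }
  destruct (uncountable_fiber Im m HIm) as [k Hk].
  exists (fun r => exists w, (Im w /\ m w = k) /\ rep w = r). split; [|split].
  - intros [h Hh]. apply Hk. exists (fun w => h (rep w)).
    intros w v Hw Hv E. apply Hh in E; eauto.
    rewrite <- (proj2 (Hrep w (proj1 Hw))), <- (proj2 (Hrep v (proj1 Hv))). now f_equal.
  - intros r [w [[Iw _] <-]]. now apply Hrep.
  - intros y Yy. destruct (Hz y Yy) as [Y1 [Y2 Y3]].
    (* [O (z y) (rep w)] gives that [w] is at most [z y], since [w] is the least index for [rep w];
       [g k y (rep w)] puts [y] in [O w], so [z y] is at most [w]. *)
    assert (Key : forall w, Im w -> m w = k -> O (z y) (rep w) -> g k y (rep w) -> w = z y).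
    { intros w Iw Ew [v [Yv [Lv Hv]]] Hg. subst k.
      destruct (Hrep w Iw) as [R1 R2]. destruct (Hz (rep w) R1) as [_ [_ R3]]. rewrite R2 in R3.
      destruct (Hm w Iw y Hg) as [u [Yu [Lu Hu]]].
      specialize (R3 v Yv Hv). specialize (Y3 u Yu Hu).
      destruct (tot w (z y)) as [H|[H|H]]; auto.
      - exfalso. destruct (tot w u) as [?|[->|?]]; eauto.
      - exfalso. destruct (tot (z y) v) as [?|[<-|?]]; eauto. }
    exists (fun t => O (z y) t /\ g k y t). split; [apply (open_inter htop); auto|split].
    + split; auto. exists (z y). auto.
    + intros r s [w [[Iw Ew] <-]] [v [[Iv Ev] <-]] [H1 H2] [H3 H4].
      rewrite (Key w), (Key v); auto.
Qed.

Lemma separable_or_discrete (Y : T -> Prop) :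
  (exists D, cnt D /\ (forall x, D x -> Y x) /\ forall y, Y y -> closure op D y) \/
  exists R, ~ cnt R /\ (forall x, R x -> Y x) /\
    forall y, Y y -> exists V, op V /\ V y /\ forall r s, R r -> R s -> V r -> V s -> r = s.
Proof.
  destruct (classic (forall n, exists E, cnt E /\ (forall x, E x -> Y x) /\
    forall y, Y y -> exists x, E x /\ g n x y)) as [H|H].
  - left. destruct (choice _ H) as [E HE]. exists (fun x => exists n, E n x). split; [|split].
    + apply cnt_union. intros n. apply HE.
    + intros x [n Hn]. now apply (HE n).
    (* For the index [n] of the neighbourhood condition for [U] at [y], any set [g n x] covering [y]
       has its centre [x] in [U]. *)
    + intros y Yy U HU Uy. destruct hg as [gop [grefl [gdec gstr]]].
      destruct (gstr y U HU Uy) as [n [N [HN [Ny HN']]]].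
      destruct (proj2 (proj2 (HE n)) y Yy) as [x [Ex Hx]]. exists x. eauto.
  - right. apply not_all_ex_not in H. destruct H as [n Hn]. eapply uncovered_discrete; eauto.
Qed.

(** Some index [k] isolates uncountably many points of [R]. Each such [r] has a point [d r] of [D]
    in [g k r] that lies in no [g k s] for another [s] in [R], so [d] is injective on them. *)
Lemma separable_discrete_countable (D R : T -> Prop) :
  cnt D -> (forall x, closure op D x) ->
  (forall r, R r -> exists V, op V /\ V r /\ forall s, R s -> V s -> s = r) -> cnt R.
Proof.
  destruct hg as [gop [grefl [gdec gstr]]]. intros [h Hh] HD HR.
  apply NNPP. intros Hc.
  destruct (choice (fun r n => R r -> exists N, op N /\ N r /\
     forall s y, R s -> N y -> g n s y -> s = r)) as [n Hn].
  { intros r. destruct (classic (R r)) as [Rr|Rr]; [|exists 0; tauto].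
    destruct (HR r Rr) as [V [HV [Vr HV']]].
    destruct (gstr r V HV Vr) as [n [N [HN [Nr HN']]]]. exists n. intros _.
    exists N. repeat split; eauto. }
  destruct (uncountable_fiber R n Hc) as [k Hk].
  destruct (choice (fun r d => R r -> n r = k -> D d /\ g k r d /\
     forall s, R s -> g k s d -> s = r)) as [d Hd].
  { intros r. destruct (classic (R r /\ n r = k)) as [[Rr Er]|H]; [|exists r; tauto].
    destruct (Hn r Rr) as [N [HN [Nr HN']]]. rewrite Er in HN'.
    destruct (HD r (fun y => N y /\ g k r y)) as [y [[Ny Hy] Dy]]; auto.
    - apply (open_inter htop); auto.
    - exists y. repeat split; eauto. }
  apply Hk. exists (fun r => h (d r)). intros r s [Rr Er] [Rs Es] E.
  destruct (Hd r Rr Er) as [D1 [G1 U1]]. destruct (Hd s Rs Es) as [D2 [G2 U2]].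
  apply Hh in E; auto. rewrite E in G1. auto.
Qed.

Lemma hereditarily_separable (D : T -> Prop) :
  cnt D -> (forall x, closure op D x) ->
  forall Y : T -> Prop, exists E, cnt E /\ (forall x, E x -> Y x) /\ forall y, Y y -> closure op E y.
Proof.
  intros HD Hd Y. destruct (separable_or_discrete Y) as [|[R [HR [RY H]]]]; auto.
  exfalso. apply HR. apply (separable_discrete_countable D); auto.
  intros r Rr. destruct (H r (RY r Rr)) as [V [HV [Vr HV']]]. exists V. auto.
Qed.

End Stratified.

(** * Free topological groups *)

Section FreeGroupWords.
Context {X : Type}.

Definition letter_inv (a : letter X) : letter X := (fst a, negb (snd a)).

Definition word_inv (w : list (letter X)) : list (letter X) := rev (map letter_inv w).

Lemma letter_inv_invol a : letter_inv (letter_inv a) = a.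
Proof. destruct a as [x b]. unfold letter_inv; simpl. now rewrite Bool.negb_involutive. Qed.

Lemma inv_letters_iff (a b : letter X) : inv_letters a b <-> b = letter_inv a.
Proof.
  destruct a as [x c], b as [y d]. unfold inv_letters, letter_inv; simpl. split.
  - intros [-> H]. f_equal. destruct c, d; simpl; congruence.
  - intros E. injection E as -> ->. split; auto. destruct c; discriminate.
Qed.

Lemma push_cases (a b : letter X) w :
  b = letter_inv a /\ push a (b :: w) = w \/ b <> letter_inv a /\ push a (b :: w) = a :: b :: w.
Proof.
  unfold push. destruct excluded_middle_informative as [H|H]; rewrite inv_letters_iff in H; auto.
Qed.

(** Van der Waerden's argument: on reduced words, pushing a letter is a permutation inverse to
    pushing its inverse. Hence a word and its reduction act alike, which replaces a confluence
    argument. *)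
Lemma push_letter_inv a z : reduced z -> push a (push (letter_inv a) z) = z.
Proof.
  intros Hz. assert (Hcancel : forall w, push a (letter_inv a :: w) = w).
  { intros w. destruct (push_cases a (letter_inv a) w) as [[_ ->]|[H _]]; congruence. }
  destruct z as [|b z]; [apply Hcancel|].
  destruct (push_cases (letter_inv a) b z) as [[-> ->]|[H ->]]; [|apply Hcancel].
  rewrite letter_inv_invol in *. destruct z as [|c z]; auto.
  destruct (push_cases a c z) as [[-> _]|[_ ->]]; auto.
  exfalso. apply Hz. now apply inv_letters_iff.
Qed.

Lemma fold_push_reduced u z : reduced z -> reduced (fold_right (@push X) z u).
Proof. intros Hz. induction u; simpl; auto. now apply push_reduced. Qed.

Lemma fold_push_push a r z :
  reduced z -> fold_right (@push X) z (push a r) = push a (fold_right (@push X) z r).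
Proof.
  intros Hz. destruct r as [|b r]; auto.
  destruct (push_cases a b r) as [[-> ->]|[_ ->]]; auto.
  simpl. now rewrite push_letter_inv by now apply fold_push_reduced.
Qed.

Lemma fold_push_reduce u z :
  reduced z -> fold_right (@push X) z (reduce u) = fold_right (@push X) z u.
Proof.
  intros Hz. induction u as [|a u IH]; auto. simpl. now rewrite fold_push_push, IH.
Qed.

Lemma fold_push_inv_push a r z : reduced z ->
  fold_right (@push X) z (word_inv (push a r)) =
  fold_right (@push X) (push (letter_inv a) z) (word_inv r).
Proof.
  intros Hz. destruct r as [|b r]; auto. unfold word_inv.
  destruct (push_cases a b r) as [[-> ->]|[_ ->]]; cbn [map rev];
    rewrite !fold_right_app; cbn [fold_right]; auto.
  now rewrite letter_inv_invol, push_letter_inv.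
Qed.

Lemma fold_push_inv_reduce v z : reduced z ->
  fold_right (@push X) z (word_inv (reduce v)) = fold_right (@push X) z (word_inv v).
Proof.
  revert z. induction v as [|a v IH]; intros z Hz; auto.
  change (reduce (a :: v)) with (push a (reduce v)).
  rewrite fold_push_inv_push, IH by auto using push_reduced.
  unfold word_inv. simpl. now rewrite fold_right_app.
Qed.

Lemma reduce_id (w : list (letter X)) : reduced w -> reduce w = w.
Proof.
  induction w as [|a w IH]; auto. intros H.
  change (reduce (a :: w)) with (push a (reduce w)). rewrite IH by apply H.
  destruct w as [|b w]; auto. destruct (push_cases a b w) as [[-> _]|[_ ->]]; auto.
  exfalso. apply H. now apply inv_letters_iff.
Qed.

Lemma FA_ext (g h : FA X) : word g = word h -> g = h.
Proof. destruct g, h. apply subset_eq_compat. Qed.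

Lemma FA_of_word (g : FA X) : FA_of (word g) = g.
Proof. apply FA_ext. simpl. apply reduce_id. exact (proj2_sig g). Qed.

(** Division is computed on arbitrary representatives, so that later arguments can work with
    unreduced words. *)
Lemma FA_div (u v : list (letter X)) :
  FA_mul (FA_of u) (FA_inv (FA_of v)) = FA_of (u ++ word_inv v).
Proof.
  apply FA_ext. change (reduce (reduce u ++ reduce (word_inv (reduce v))) = reduce (u ++ word_inv v)).
  unfold reduce at 1. rewrite fold_right_app. fold (reduce (reduce (word_inv (reduce v)))).
  rewrite fold_push_reduce, reduce_id by apply reduce_reduced.
  unfold reduce at 1. rewrite (fold_push_inv_reduce v []) by exact I.
  unfold reduce. now rewrite fold_right_app.
Qed.

End FreeGroupWords.

(** * The free group topology and the space of words *)

Section GeneratedTopology.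
Context {T : Type}.
Variable S : (T -> Prop) -> Prop.

Lemma generated_is_topology : is_topology (generated_topology S).
Proof.
  split; [|split].
  - intros op' H _. apply H.
  - intros U V HU HV op' H HS. apply H; [apply HU|apply HV]; auto.
  - intros F HF op' H HS. apply H. intros U FU. apply (HF U FU); auto.
Qed.

Lemma generated_in O : S O -> generated_topology S O.
Proof. intros HO op' H HS. auto. Qed.

End GeneratedTopology.

Section FreeTopology.
Context {X : Type}.
Variable opX : (X -> Prop) -> Prop.
Lemma free_top_in (tau : (FA X -> Prop) -> Prop) O :
  is_group_topology tau -> continuous_into opX tau (eta (X := X)) -> tau O -> free_top opX O.
Proof. intros H1 H2 H3. apply generated_in. exists tau. auto. Qed.

Lemma free_top_is_group_topology : is_group_topology (free_top opX).
Proof.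
  assert (Htop : is_topology (free_top opX)) by apply generated_is_topology.
  split; auto. intros g h O HO.
  (* Membership in the generated topology is an induction principle: the sets satisfying this clause
     at the fixed pair [g], [h] form a topology containing the generators. *)
  apply (HO (fun O => O (FA_mul g (FA_inv h)) -> exists U V : FA X -> Prop,
    free_top opX U /\ free_top opX V /\ U g /\ V h /\
    forall g' h', U g' -> V h' -> O (FA_mul g' (FA_inv h')))).
  - split; [|split].
    + intros _. exists (fun _ => True), (fun _ => True). repeat split; auto; apply Htop.
    + intros O1 O2 H1 H2 [P1 P2].
      destruct (H1 P1) as [U1 [V1 [A1 [B1 [C1 [D1 E1]]]]]].
      destruct (H2 P2) as [U2 [V2 [A2 [B2 [C2 [D2 E2]]]]]].
      exists (fun x => U1 x /\ U2 x), (fun x => V1 x /\ V2 x).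
      split; [now apply Htop|split; [now apply Htop|]]. firstorder.
    + intros F HF [O' [FO HO']]. destruct (HF O' FO HO') as [U [V [A1 [B1 [C1 [D1 E1]]]]]].
      exists U, V. repeat split; auto. eauto.
  - intros U [tau [[H1 H2] [H3 H4]]] HU.
    destruct (H2 g h U H4 HU) as [V [W [A1 [B1 H]]]].
    exists V, W. split; [|split; [|exact H]]; eapply free_top_in; eauto; split; auto.
Qed.

Hypothesis hX : is_topology opX.

Lemma free_top_eta : continuous_into opX (free_top opX) (eta (X := X)).
Proof.
  intros O HO. apply (HO (fun O => opX (fun x => O (eta x)))).
  - split; [|split].
    + apply (open_full hX).
    + intros U V. apply (open_inter hX).
    + intros F HF. apply (open_local hX). intros x [U [FU Ux]].
      exists (fun x => U (eta x)). repeat split; eauto.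
  - intros U [tau [_ [H1 H2]]]. now apply H1.
Qed.

Lemma free_top_discrete : discrete opX -> discrete (free_top opX).
Proof.
  intros Hd O. apply free_top_in with (tau := fun _ => True); auto.
  - split; [repeat split|]. intros g h P _ HP.
    exists (fun x => x = g), (fun x => x = h). repeat split; auto. now intros ? ? -> ->.
  - intros P _. apply Hd.
Qed.

(* Words carry the topology of the disjoint union of the powers of X * bool;
   basic neighbourhoods prescribe the length, the exponents and an open set per letter. *)
Definition in_box (bs : list ((X -> Prop) * bool)) (w : list (letter X)) : Prop :=
  Forall2 (fun c l => fst c (fst l) /\ snd c = snd l) bs w.

Definition open_box (bs : list ((X -> Prop) * bool)) : Prop := Forall (fun c => opX (fst c)) bs.

Definition word_top (O : list (letter X) -> Prop) : Prop :=
  forall w, O w -> exists bs, open_box bs /\ in_box bs w /\ forall w', in_box bs w' -> O w'.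

Lemma box_and bs1 bs2 w : open_box bs1 -> open_box bs2 -> in_box bs1 w -> in_box bs2 w ->
  exists bs, open_box bs /\ in_box bs w /\ forall w', in_box bs w' -> in_box bs1 w' /\ in_box bs2 w'.
Proof.
  intros O1 O2 H1. revert bs2 O1 O2.
  induction H1 as [|[U b] l bs1 w [H1 H1'] H IH]; intros bs2 O1 O2 H2.
  - inversion H2; subst. exists []. split; [constructor|split; [constructor|auto]].
  - inversion H2 as [|[V c] ? bs2' ? [H3 H3'] H4]; subst. inversion O1; inversion O2; subst.
    destruct (IH bs2') as [bs [Ob [Hb Hb']]]; auto. simpl in *. subst.
    exists ((fun x => U x /\ V x, snd l) :: bs). split; [|split].
    + constructor; auto. simpl. now apply (open_inter hX).
    + constructor; simpl; auto.
    + intros w' Hw'. inversion Hw' as [|? l' ? w'' [G1 G2] G3]; subst. simpl in *. destruct G1.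
      destruct (Hb' w'' G3). split; constructor; simpl; auto.
Qed.

Lemma word_top_is_topology : is_topology word_top.
Proof.
  split; [|split].
  - intros w _. exists (map (fun l => (fun _ => True, snd l)) w). split; [|split; auto].
    + apply Forall_forall. intros c Hc. apply in_map_iff in Hc. destruct Hc as [l [<- _]].
      apply (open_full hX).
    + induction w; constructor; simpl; auto.
  - intros U V HU HV w [Uw Vw].
    destruct (HU w Uw) as [b1 [O1 [B1 H1]]]. destruct (HV w Vw) as [b2 [O2 [B2 H2]]].
    destruct (box_and b1 b2 w) as [bs [Ob [Hb Hb']]]; auto. exists bs. firstorder.
  - intros F HF w [U [FU Uw]]. destruct (HF U FU w Uw) as [bs [O1 [H1 H2]]].
    exists bs. repeat split; eauto.
Qed.

(** A group topology is given by continuous division, so words are built by division: an inverse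
    letter is the empty word divided by a letter, and appending a letter is division by its
    inverse. *)
Lemma continuous_FA_of (tau : (FA X -> Prop) -> Prop) :
  is_group_topology tau -> continuous_into opX tau (eta (X := X)) ->
  forall O, tau O -> word_top (fun w => O (FA_of w)).
Proof.
  intros [Htop Hdiv] Heta.
  assert (Hgen : forall x O, tau O -> O (FA_of [(x, true)]) ->
    exists U, opX U /\ U x /\ forall y, U y -> O (FA_of [(y, true)])).
  { intros x O HO Ox. exists (fun y => O (eta y)).
    assert (E : forall y : X, eta y = FA_of [(y, true)]) by (intros; now apply FA_ext).
    split; [now apply Heta|]. split; [|intros y]; now rewrite E. }
  assert (Hletter : forall x b O, tau O -> O (FA_of [(x, b)]) ->
    exists U, opX U /\ U x /\ forall y, U y -> O (FA_of [(y, b)])).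
  { intros x [] O HO Ox; [now apply Hgen|].
    change [(x, false)] with ([] ++ word_inv [(x, true)]) in Ox. rewrite <- FA_div in Ox.
    destruct (Hdiv _ _ O HO Ox) as [U [V [HU [HV [Ue [Vx H]]]]]].
    destruct (Hgen x V HV Vx) as [W [HW [Wx HW']]]. exists W. repeat split; auto.
    intros y Wy. change [(y, false)] with ([] ++ word_inv [(y, true)]). rewrite <- FA_div. auto. }
  intros O HO w. revert O HO. induction w as [|[x b] w IH] using rev_ind; intros O HO Ow.
  - exists []. repeat split; try constructor. intros w' Hw'. now inversion Hw'.
  - assert (E : forall (u : list (letter X)) (y : X), u ++ [(y, b)] = u ++ word_inv [(y, negb b)])
      by (intros; unfold word_inv, letter_inv; simpl; now rewrite Bool.negb_involutive).
    rewrite E, <- FA_div in Ow.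
    destruct (Hdiv _ _ O HO Ow) as [U [V [HU [HV [Ue [Vx H]]]]]].
    destruct (IH U HU Ue) as [bs [Ob [Bw Hb]]].
    destruct (Hletter _ _ V HV Vx) as [W [HW [Wx HW']]].
    exists (bs ++ [(W, b)]). split; [|split].
    + apply Forall_app. split; [auto|constructor; [exact HW|constructor]].
    + apply Forall2_app; [exact Bw|]. constructor; [simpl; auto|constructor].
    + intros w' Hw'. apply Forall2_app_inv_l in Hw'. destruct Hw' as [w1 [w2 [H1 [H2 ->]]]].
      inversion H2 as [|? [y c] ? ? [H3 H4] H5]; subst. inversion H5; subst. simpl in *. subst c.
      rewrite E, <- FA_div. auto.
Qed.

Lemma stratifying_words g : stratifying opX g ->
  stratifying word_top (fun n w => in_box (map (fun l => (g n (fst l), snd l)) w)).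
Proof.
  intros [gop [grefl [gdec gstr]]]. split; [|split; [|split]].
  - intros n w w' Hw'. exists (map (fun l => (g n (fst l), snd l)) w). repeat split; auto.
    apply Forall_forall. intros c Hc. apply in_map_iff in Hc. destruct Hc as [l [<- _]].
    apply gop.
  - intros n w. induction w; constructor; simpl; auto.
  - intros n m w. induction w as [|l w IH]; intros w' Hnm H; inversion H as [|? l' ? ? [H1 H2] H3]; subst;
      constructor; simpl in *; eauto. apply IH; auto.
  - intros p W HW Wp. destruct (HW p Wp) as [bs [Ob [Bp Hbs]]].
    (* The claim covers every [m >= n], so that the index of a word can be the maximum of those of
       its letters. *)
    assert (exists n bs', open_box bs' /\ in_box bs' p /\ forall m w w', n <= m -> in_box bs' w' ->
      in_box (map (fun l => (g m (fst l), snd l)) w) w' -> in_box bs w) as [n [bs' [O1 [B1 H]]]].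
    { clear Hbs Wp. induction Bp as [|[U b] l bs p [H1 H1'] Bp IH].
      - exists 0, []. repeat split; try constructor.
        intros m [|l w] w' _ H1 H2; inversion H1; subst; inversion H2. constructor.
      - inversion Ob; subst. destruct IH as [n [bs' [O1 [B1 H]]]]; auto.
        destruct (gstr (fst l) U) as [k [N [HN [Nl HN']]]]; auto.
        exists (Nat.max n k), ((N, b) :: bs'). split; [constructor; auto|split; [constructor; auto|]].
        intros m w w' Hm Hw' Hg. inversion Hw' as [|? l' ? w1 [H4 H4'] H5]; subst.
        destruct w as [|l0 w]; inversion Hg as [|? ? ? ? [H6 H6'] H7]; subst. simpl in *.
        constructor; simpl.
        + split; [|congruence]. apply HN' with (fst l'); auto. apply (gdec k m); auto; lia.
        + apply (H m w w1); auto; lia. }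
    exists n, (in_box bs'). repeat split; auto.
    + intros w Hw. eauto.
    + intros x y H1 H2. apply Hbs. eauto.
Qed.

Lemma dense_words (D : X -> Prop) : (forall x, closure opX D x) ->
  forall w, closure word_top (Forall (fun l => D (fst l))) w.
Proof.
  intros HD w O HO Ow. destruct (HO w Ow) as [bs [Ob [Bw Hbs]]].
  assert (exists w', in_box bs w' /\ Forall (fun l => D (fst l)) w') as [w' [H1 H2]]; [|eauto].
  clear Hbs Ow. induction Bw as [|[U b] l bs w [H1 H1'] Bw IH].
  - exists []. split; constructor.
  - inversion Ob; subst. destruct IH as [w' [H4 H5]]; auto.
    destruct (HD (fst l) U) as [y [Uy Dy]]; auto.
    exists ((y, b) :: w'). split; constructor; auto.
Qed.

(** The preimage of [A] in the space of words is separable. Since [FA_of] is continuous and onto,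
    the image of a countable dense subset of it has [A], hence [y], in its closure. *)
Lemma separable_countable_tightness g :
  stratifying opX g -> separable opX -> countable_tightness (free_top opX).
Proof.
  intros hg [D [HD Hd]] A y _ _ Hy.
  destruct (hereditarily_separable word_top_is_topology (stratifying_words g hg)
    (Forall (fun l => D (fst l)))) with (Y := fun w => A (FA_of w)) as [E [HE [EA HEd]]].
  - apply cnt_list, cnt_letters. now apply countable_cnt.
  - now apply dense_words.
  - exists (fun z => exists w, E w /\ FA_of w = z). split; [|split].
    + intros z [w [Ew <-]]. auto.
    + apply (cnt_countable (FA_of [])). now apply cnt_image.
    + intros U HU Uy. destruct (Hy U HU Uy) as [z [Uz Az]]. rewrite <- (FA_of_word z) in Uz, Az.
      destruct (HEd (word z) Az (fun w => U (FA_of w))) as [w [Uw Ew]]; auto.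
      * apply continuous_FA_of with (free_top opX); auto.
        -- apply free_top_is_group_topology.
        -- apply free_top_eta.
      * exists (FA_of w). eauto.
Qed.

End FreeTopology.

(** * Continuous real functions on a stratifiable space *)

Open Scope R_scope.

Lemma pow2_pos n : 0 < 2 ^ n.
Proof. apply pow_lt; lra. Qed.

Lemma dyadic_between a b : 0 <= a -> a < b -> exists n k, a < INR k / 2 ^ n < b.
Proof.
  intros Ha Hab.
  destruct (pow_lt_1_zero (1/2)) with (y := b - a) as [n Hn]; [rewrite Rabs_pos_eq; lra|lra|].
  specialize (Hn n (Nat.le_refl n)).
  rewrite Rabs_pos_eq in Hn by (apply pow_le; lra).
  unfold Rdiv in Hn; rewrite Rmult_1_l, pow_inv in Hn.
  pose proof (pow2_pos n) as Hp.
  exists n, (Z.to_nat (up (a * 2 ^ n))).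
  destruct (archimed (a * 2 ^ n)) as [H1 H2].
  assert (H0 : 0 <= a * 2 ^ n) by (apply Rmult_le_pos; lra).
  rewrite INR_IZR_INZ, Z2Nat.id by (apply le_IZR; lra).
  assert (H3 : / 2 ^ n * 2 ^ n = 1) by (field; lra).
  split; apply Rmult_lt_reg_r with (2 ^ n); auto; unfold Rdiv; rewrite Rmult_assoc, H3; nra.
Qed.

Section RealFunctions.
Context {T : Type} {op : (T -> Prop) -> Prop} {g : nat -> T -> T -> Prop}.
Hypothesis htop : is_topology op.
Hypothesis hg : stratifying op g.

(** Continuity, tested on the open rays, which form a subbase of the line. *)
Definition cont (u : T -> R) : Prop :=
  forall r, op (fun x => u x < r) /\ op (fun x => r < u x).

Lemma open_const (P : Prop) : op (fun _ => P).
Proof.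
  apply (open_local htop). intros y H. exists (fun _ => True).
  split; [apply (open_full htop)|auto].
Qed.

Lemma cont_const c : cont (fun _ => c).
Proof. intros r; split; apply open_const. Qed.

Lemma cont_scal c u : 0 <= c -> cont u -> cont (fun x => c * u x).
Proof.
  intros Hc Hu r. destruct (Req_dec c 0) as [->|H].
  - split; [apply open_iff with (fun _ => 0 < r)|apply open_iff with (fun _ => r < 0)];
      auto using open_const; intros x; rewrite Rmult_0_l; tauto.
  - assert (H3 : r = c * (r / c)) by (field; lra). split.
    + apply open_iff with (fun x => u x < r / c); auto; [apply Hu|].
      intros x. rewrite H3 at 2. split; intros; [apply Rmult_lt_compat_l|apply Rmult_lt_reg_l with c]; lra.
    + apply open_iff with (fun x => r / c < u x); auto; [apply Hu|].
      intros x. rewrite H3 at 2. split; intros; [apply Rmult_lt_compat_l|apply Rmult_lt_reg_l with c]; lra.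
Qed.

Lemma cont_plus_const c u : cont u -> cont (fun x => c + u x).
Proof.
  intros Hu r; split.
  - apply open_iff with (fun x => u x < r - c); auto; [apply Hu|]. intros; split; lra.
  - apply open_iff with (fun x => r - c < u x); auto; [apply Hu|]. intros; split; lra.
Qed.

(** * Urysohn functions *)

Definition strongly_inside (V U : T -> Prop) : Prop :=
  op V /\ op U /\ forall x, closure op V x -> U x.

Lemma strongly_inside_subset V U x : strongly_inside V U -> V x -> U x.
Proof. intros [_ [_ H]] Vx. apply H. now apply subset_closure. Qed.

(** Urysohn's scale, indexed by the dyadic rationals [k / 2 ^ n]: a finer level keeps the old sets
    at even [k] and interpolates by [mid] at odd [k]. *)
Fixpoint dyadic (mid : (T -> Prop) * (T -> Prop) -> T -> Prop) (base : nat -> T -> Prop)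
  (n k : nat) : T -> Prop :=
  match n with
  | O => base k
  | S n => if Nat.even k then dyadic mid base n (Nat.div2 k)
           else mid (dyadic mid base n (Nat.div2 k), dyadic mid base n (S (Nat.div2 k)))
  end.

Section Dyadic.
Variables (mid : (T -> Prop) * (T -> Prop) -> T -> Prop) (base : nat -> T -> Prop).
Hypothesis Hmid : forall VU, strongly_inside (fst VU) (snd VU) ->
  strongly_inside (fst VU) (mid VU) /\ strongly_inside (mid VU) (snd VU).
Hypothesis Hbase : forall k, strongly_inside (base k) (base (S k)).
Let P := dyadic mid base.

Lemma dyadic_even n j : P (S n) (2 * j) = P n j.
Proof.
  unfold P; cbn [dyadic]. now rewrite Nat.even_even, Nat.div2_double.
Qed.

Lemma dyadic_odd n j : P (S n) (S (2 * j)) = mid (P n j, P n (S j)).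
Proof.
  unfold P; cbn [dyadic]. rewrite Nat.even_succ, <- Nat.negb_even, Nat.even_even. simpl negb; cbv iota.
  now rewrite Nat.div2_succ_double.
Qed.

Lemma dyadic_step n k : strongly_inside (P n k) (P n (S k)).
Proof.
  revert k; induction n as [|n IH]; intros k; [apply Hbase|].
  destruct (Nat.Even_or_Odd k) as [[j ->]|[j ->]].
  - rewrite dyadic_even, dyadic_odd. apply (Hmid (P n j, P n (S j))), IH.
  - replace (S (2 * j + 1)) with (2 * S j)%nat by lia.
    rewrite Nat.add_1_r, dyadic_even, dyadic_odd. apply (Hmid (P n j, P n (S j))), IH.
Qed.

Lemma dyadic_mono n k j x : (k <= j)%nat -> P n k x -> P n j x.
Proof.
  induction 1; auto. intros H1. apply IHle in H1.
  revert H1. apply strongly_inside_subset, dyadic_step.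
Qed.

Lemma dyadic_refine n m k : P n k = P (m + n) (k * 2 ^ m)%nat.
Proof.
  revert k; induction m as [|m IH]; intros k.
  - now rewrite Nat.pow_0_r, Nat.mul_1_r.
  - rewrite Nat.pow_succ_r', (Nat.mul_comm 2), Nat.mul_assoc, (Nat.mul_comm _ 2), Nat.add_succ_l, dyadic_even.
    apply IH.
Qed.

(** Both fractions are brought to the denominator [2 ^ (n + m)], where each set contains the closure
    of its predecessor. *)
Lemma dyadic_closure n k m j x :
  INR k / 2 ^ n < INR j / 2 ^ m -> closure op (P n k) x -> P m j x.
Proof.
  intros H. rewrite (dyadic_refine n m k), (dyadic_refine m n j), (Nat.add_comm n m).
  intros Hx. apply dyadic_mono with (S (k * 2 ^ m)).
  - apply INR_lt. rewrite !mult_INR, !pow_INR. simpl (INR 2).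
    pose proof (pow2_pos n). pose proof (pow2_pos m).
    apply Rmult_lt_compat_r with (r := 2 ^ n * 2 ^ m) in H; [|nra].
    unfold Rdiv in H.
    replace (INR k * / 2 ^ n * (2 ^ n * 2 ^ m)) with (INR k * 2 ^ m) in H by (field; lra).
    replace (INR j * / 2 ^ m * (2 ^ n * 2 ^ m)) with (INR j * 2 ^ n) in H by (field; lra).
    exact H.
  - now apply dyadic_step.
Qed.

End Dyadic.

Lemma urysohn p U : op U -> U p ->
  exists u, cont u /\ (forall x, 0 <= u x <= 1) /\ u p = 1 /\ forall x, ~ U x -> u x = 0.
Proof.
  intros HU Up.
  destruct (choice (fun (VU : (T -> Prop) * (T -> Prop)) M => strongly_inside (fst VU) (snd VU) ->
     strongly_inside (fst VU) M /\ strongly_inside M (snd VU))) as [mid Hmid].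
  { intros [V W]. destruct (classic (strongly_inside V W)) as [[HV [HW H]]|H].
    - destruct (stratifying_normal htop hg V W HW H) as [M [HM [H1 H2]]]. exists M.
      intros _. repeat split; auto.
    - exists V. tauto. }
  destruct (stratifying_regular hg p U HU Up) as [V [HV [Vp HVU]]].
  (* [U] gets the value 1, and the whole space from 2 on bounds the supremum [s] taken below. *)
  set (base := fun k : nat => match k with O => V | 1%nat => U | _ => fun _ => True end).
  assert (Hbase : forall k, strongly_inside (base k) (base (S k))).
  { intros [|[|k]]; repeat split; auto; apply (open_full htop). }
  pose proof (dyadic_closure mid base Hmid Hbase) as HC.
  set (P := dyadic mid base) in *.
  (* [E y] collects the dyadics whose set misses [y]; the alternative [k = O] puts 0 into it, so
     that it is never empty. *)
  set (E := fun y t => exists n k, t = INR k / 2 ^ n /\ (k = O \/ ~ P n k y)).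
  assert (HPop : forall n k, op (P n k)) by (intros; now apply (dyadic_step mid base)).
  assert (HE : forall y t c, E y t -> (exists n k, c = INR k / 2 ^ n /\ P n k y) -> t <= c).
  { intros y t c [n [k [-> Hk]]] [m [j [-> Hj]]].
    destruct Hk as [->|Hk].
    - simpl INR. unfold Rdiv. rewrite Rmult_0_l. apply Rmult_le_pos; [apply pos_INR|].
      left; apply Rinv_0_lt_compat, pow2_pos.
    - apply Rnot_lt_le. intros H. apply Hk, (HC m j n k); auto. now apply subset_closure. }
  assert (Hlub : forall y, exists s, is_lub (E y) s).
  { intros y. destruct (completeness (E y)) as [s Hs]; [| |eauto].
    - exists (INR 2 / 2 ^ 0). intros t Ht. apply (HE y t); auto. exists O, 2%nat.
      split; auto. exact I.
    - exists (INR 0 / 2 ^ 0), O, O. auto. }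
  destruct (choice _ Hlub) as [s Hs]. clear Hlub.
  assert (Hs0 : forall y, 0 <= s y).
  { intros y. apply Hs. exists O, O. split; auto. simpl; lra. }
  assert (Hlt : forall r, op (fun y => s y < r)).
  { intros r. apply (open_local htop). intros y Hy.
    destruct (dyadic_between (s y) r (Hs0 y) Hy) as [n [k [H1 H2]]].
    exists (P n k). split; auto. split.
    - apply NNPP. intros Hk. apply Rlt_not_le in H1. apply H1, Hs. exists n, k. auto.
    - intros z Hz. apply Rle_lt_trans with (INR k / 2 ^ n); auto. apply Hs.
      intros t Ht. apply (HE z t); eauto. }
  assert (Hgt : forall r, op (fun y => r < s y)).
  { intros r. apply (open_local htop). intros y Hy.
    destruct (Rlt_le_dec r 0) as [Hr|Hr].
    { exists (fun _ => True). split; [apply (open_full htop)|split; auto].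
      intros z _. specialize (Hs0 z). lra. }
    assert (exists t, E y t /\ r < t) as [t [[n [k [-> Hk]]] Ht]].
    { apply NNPP. intros H. apply Rlt_not_le in Hy. apply Hy, Hs. intros t Ht.
      apply Rnot_lt_le. intros H'. apply H; eauto. }
    destruct Hk as [->|Hk]; [simpl in Ht; lra|].
    destruct (dyadic_between r _ Hr Ht) as [m [j [H1 H2]]].
    exists (fun z => ~ closure op (P m j) z). split; [apply (open_not_closure htop)|split].
    - intros H. apply Hk. revert H. now apply HC.
    - intros z Hz. apply Rlt_le_trans with (INR j / 2 ^ m); auto. apply Hs.
      exists m, j. split; auto. right. intros H. apply Hz. now apply subset_closure. }
  (* [s] vanishes at [p], which lies in the set of index 0, and is at least 1 outside [U], the set
     of index 1. *)
  exists (fun x => Rmax 0 (1 - s x)). split; [|split; [|split]].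
  - intros r; split.
    + destruct (Rlt_le_dec 0 r).
      * apply open_iff with (fun x => 1 - r < s x); auto. intros x.
        unfold Rmax. destruct Rle_dec; split; lra.
      * apply open_iff with (fun _ => False); auto using open_const. intros x.
        unfold Rmax. destruct Rle_dec; split; lra.
    + destruct (Rlt_le_dec r 0).
      * apply open_iff with (fun _ => True); auto using open_const. intros x.
        unfold Rmax. destruct Rle_dec; split; lra.
      * apply open_iff with (fun x => s x < 1 - r); auto. intros x.
        unfold Rmax. destruct Rle_dec; split; lra.
  - intros x. specialize (Hs0 x). unfold Rmax. destruct Rle_dec; lra.
  - assert (s p <= 0).
    { apply Hs. intros t Ht. replace 0 with (INR 0 / 2 ^ 0) by (simpl; lra).
      apply (HE p); auto. exists O, O. auto. }
    specialize (Hs0 p). unfold Rmax. destruct Rle_dec; lra.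
  - intros x Ux.
    assert (1 <= s x).
    { apply Hs. exists O, 1%nat. split; [simpl; lra|]. now right. }
    unfold Rmax. destruct Rle_dec; lra.
Qed.

(** A supremum of continuous functions is lower semicontinuous. As the tails are uniformly small
    near each point, upper semicontinuity there reduces to finitely many functions. *)
Lemma sup_cont (v : nat -> T -> R) :
  (forall k, cont (v k)) -> (forall k y, 0 <= v k y) ->
  (forall y eps, 0 < eps -> exists W m, op W /\ W y /\
     forall k z, (m <= k)%nat -> W z -> v k z <= eps) ->
  exists s, cont s /\ (forall k y, v k y <= s y) /\ (forall y c, (forall k, v k y <= c) -> s y <= c).
Proof.
  intros Hc H0 Htail.
  assert (Hlub : forall y, exists s, is_lub (fun t => exists k, t = v k y) s).
  { intros y. destruct (completeness (fun t => exists k, t = v k y)) as [s Hs]; [| |eauto].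
    2: { now exists (v O y), O. }
    destruct (Htail y 1 Rlt_0_1) as [W [m [_ [Wy HW]]]].
    assert (Hb : forall n, exists b, forall k, (k < n)%nat -> v k y <= b).
    { induction n as [|n [b Hb]]; [exists 0; intros; lia|].
      exists (Rmax b (v n y)). intros k Hk. destruct (Nat.eq_dec k n) as [->|].
      - apply Rmax_r.
      - apply Rle_trans with b; [apply Hb; lia|apply Rmax_l]. }
    destruct (Hb m) as [b Hb']. exists (Rmax b 1). intros t [k ->].
    destruct (le_lt_dec m k).
    - apply Rle_trans with 1; auto using Rmax_r.
    - apply Rle_trans with b; auto using Rmax_l. }
  destruct (choice _ Hlub) as [s Hs]. clear Hlub.
  assert (Hvs : forall k y, v k y <= s y) by (intros; apply Hs; eauto).
  assert (Hsv : forall y c, (forall k, v k y <= c) -> s y <= c).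
  { intros y c H. apply Hs. intros t [k ->]. auto. }
  exists s. split; [|auto]. intros r; split.
  - apply (open_local htop). intros y Hy.
    assert (0 <= s y) by (apply Rle_trans with (v O y); auto).
    (* This threshold lies strictly between [s y] and [r], and is positive because [s y] is
       nonnegative. *)
    destruct (Htail y ((s y + r) / 2)) as [W [m [HW [Wy H1]]]]; [lra|].
    exists (fun z => W z /\ forall i, (i < m)%nat -> v i z < (s y + r) / 2). split; [|split].
    + apply (open_inter htop); auto. apply (open_forall_lt htop). intros; apply Hc.
    + split; auto. intros i _. specialize (Hvs i y). lra.
    + intros z [Wz Hz]. apply Rle_lt_trans with ((s y + r) / 2); [|lra].
      apply Hsv. intros k. destruct (le_lt_dec m k); auto. left; auto.
  - apply (open_local htop). intros y Hy.
    assert (exists k, r < v k y) as [k Hk].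
    { apply NNPP. intros H. apply Rlt_not_le in Hy. apply Hy, Hsv. intros k.
      apply Rnot_lt_le. eauto. }
    exists (fun z => r < v k z). split; [apply Hc|split; auto].
    intros z Hz. specialize (Hvs k z). lra.
Qed.

Lemma positive_on_sequence (p : T) (x : nat -> T) :
  (forall n, exists U, op U /\ U (x n) /\ ~ U p) ->
  exists b, cont b /\ b p = 0 /\ forall n, 0 < b (x n).
Proof.
  intros Hx.
  destruct (choice (fun n u => cont u /\ (forall y, 0 <= u y <= 1) /\ u (x n) = 1 /\ u p = 0))
    as [u Hu].
  { intros n. destruct (Hx n) as [U [HU [Ux Up]]].
    destruct (urysohn (x n) U HU Ux) as [u [H1 [H2 [H3 H4]]]]. exists u. auto. }
  assert (Hpos : forall k, 0 < / INR (S k)) by (intros; apply Rinv_0_lt_compat, lt_0_INR; lia).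
  (* The weights tend to 0, which makes the tails uniformly small, while each keeps the supremum
     positive at its [x k]. *)
  destruct (sup_cont (fun k y => / INR (S k) * u k y)) as [b [Hb [Hb1 Hb2]]].
  - intros k. apply cont_scal; [left; auto|apply Hu].
  - intros k y. apply Rmult_le_pos; [left; auto|apply Hu].
  - intros y eps Heps. destruct (archimed_cor1 eps Heps) as [N [HN1 HN2]].
    exists (fun _ => True), N. split; [apply (open_full htop)|split; auto].
    intros k z Hk _. apply Rle_trans with (/ INR (S k)).
    + destruct (proj1 (proj2 (Hu k)) z). pose proof (Hpos k). nra.
    + apply Rle_trans with (/ INR N); [|lra]. apply Rinv_le_contravar.
      * apply lt_0_INR; lia.
      * apply le_INR; lia.
  - exists b. split; [auto|split].
    + apply Rle_antisym.
      * apply Hb2. intros k. replace (u k p) with 0 by (symmetry; apply Hu). lra.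
      * specialize (Hb1 O p). replace (u O p) with 0 in Hb1 by (symmetry; apply Hu). lra.
    + intros n. specialize (Hb1 n (x n)). replace (u n (x n)) with 1 in Hb1 by (symmetry; apply Hu).
      specialize (Hpos n). lra.
Qed.

(** Each [d] gets a Urysohn bump of height at least [lam d - 1] supported in [g (n0 + h d) d].
    Shrinking with [h d] makes the bumps locally finite, and the offset [n0] keeps them off [N0]. *)
Lemma large_on_discrete (D : T -> Prop) (lam : T -> R) (n0 : nat) (N0 : T -> Prop) :
  cnt D ->
  (forall y, exists V, op V /\ V y /\ forall r s, D r -> D s -> V r -> V s -> r = s) ->
  (forall d y, D d -> N0 y -> ~ g n0 d y) ->
  exists a, cont a /\ (forall y, 1 <= a y) /\ (forall d, D d -> lam d <= a d) /\
    forall y, N0 y -> a y = 1.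
Proof.
  intros [h Hh] HD HN0. pose proof hg as [gop [grefl [gdec gstr]]].
  destruct (choice (fun k v => cont v /\ (forall y, 0 <= v y) /\
    (forall d, D d -> h d = k -> lam d - 1 <= v d) /\
    forall y, 0 < v y -> exists d, D d /\ h d = k /\ g (n0 + k)%nat d y)) as [v Hv].
  { intros k. destruct (classic (exists d, D d /\ h d = k)) as [[d [Dd Hd]]|H].
    - destruct (urysohn d (g (n0 + k)%nat d)) as [u [H1 [H2 [H3 H4]]]]; auto.
      assert (Hm : 0 <= Rmax 0 (lam d - 1)) by apply Rmax_l.
      exists (fun y => Rmax 0 (lam d - 1) * u y). split; [now apply cont_scal|split; [|split]].
      + intros y. apply Rmult_le_pos; auto. apply H2.
      + intros d' Dd' Hd'. assert (d' = d) by (apply Hh; congruence). subst d'.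
        rewrite H3, Rmult_1_r. apply Rmax_r.
      + intros y Hy. exists d. repeat split; auto. apply NNPP. intros Hn.
        rewrite (H4 y Hn) in Hy. lra.
    - exists (fun _ => 0). split; [apply cont_const|split; [intros; lra|split]].
      + intros d Dd Hd. exfalso; eauto.
      + intros; lra. }
  destruct (sup_cont v) as [s [Hs [Hs1 Hs2]]]; try (intros; apply Hv).
  - intros y eps Heps. destruct (HD y) as [V [HV [Vy HV']]].
    destruct (gstr y V HV Vy) as [n [N [HN [Ny HN']]]].
    (* [V] contains at most one point of [D]; for [k] beyond its index and [n], a bump reaching into
       [N] would have its centre in [V]. *)
    assert (exists m, forall d, D d -> V d -> (h d < m)%nat) as [m Hm].
    { destruct (classic (exists d, D d /\ V d)) as [[d [Dd Vd]]|H].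
      - exists (S (h d)). intros d' Dd' Vd'. rewrite (HV' d' d); auto.
      - exists O. intros d Dd Vd. exfalso; eauto. }
    exists N, (Nat.max n m). split; [auto|split; auto].
    intros k z Hk Nz. apply Rnot_lt_le. intros H.
    destruct (proj2 (proj2 (proj2 (Hv k))) z) as [d [Dd [Hd Gd]]]; [lra|].
    specialize (Hm d Dd). assert (V d); [|intuition lia].
    apply (HN' d z); auto. apply (gdec n (n0 + k)%nat); auto; lia.
  - exists (fun y => 1 + s y). split; [now apply cont_plus_const|split; [|split]].
    + intros y. specialize (Hs1 O y). pose proof (proj1 (proj2 (Hv O)) y). lra.
    + intros d Dd. specialize (Hs1 (h d) d).
      pose proof (proj1 (proj2 (proj2 (Hv (h d)))) d Dd eq_refl). lra.
    + intros y Ny.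
      assert (s y <= 0).
      { apply Hs2. intros k. apply Rnot_lt_le. intros H.
        destruct (proj2 (proj2 (proj2 (Hv k))) y H) as [d [Dd [Hd Gd]]].
        apply (HN0 d y); auto. apply (gdec n0 (n0 + k)%nat); auto; lia. }
      specialize (Hs1 O y). pose proof (proj1 (proj2 (Hv O)) y). lra.
Qed.

(* In a compact set containing p, the sets [g n p] trace a neighbourhood base at p. *)
Lemma convergent_sequence : T1 op -> k_space op -> ~ discrete op ->
  exists (p : T) (x : nat -> T), (forall n, x n <> p) /\
    forall U, op U -> U p -> exists N, forall n, (N <= n)%nat -> U (x n).
Proof.
  intros HT1 Hk Hnd. pose proof hg as [gop [grefl [gdec gstr]]].
  assert (exists p, ~ op (fun y => y = p)) as [p Hp].
  { apply not_all_ex_not. intros H. apply Hnd. intros U. apply (open_local htop).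
    intros x Ux. exists (fun y => y = x). repeat split; auto. now intros y ->. }
  (* If no compact set accumulates at [p], the complement of [p] meets every compact set in a
     relatively closed set, and the [k]-space property makes [p] isolated. *)
  assert (exists K, compact_set op K /\ forall U, op U -> U p -> exists y, K y /\ U y /\ y <> p)
    as [K [HK HKp]].
  { apply NNPP. intros Hno. apply Hp.
    apply open_iff with (fun y => ~ y <> p); auto; [|intros y; split; [apply NNPP|tauto]].
    apply (Hk (fun y => y <> p)). intros K HK.
    assert (exists U, op U /\ U p /\ forall y, K y -> U y -> y = p) as [U [HU [Up HU']]].
    { apply NNPP. intros H. apply Hno. exists K. split; auto. intros U HU Up.
      apply NNPP. intros H'. apply H. exists U. repeat split; auto. intros y Ky Uy.
      apply NNPP. intros E. apply H'. exists y. auto. }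
    exists (fun y => ~ U y). split.
    - unfold closed. apply open_iff with U; auto. intros y; split; [tauto|apply NNPP].
    - intros y Ky. split.
      + intros [Hy _] Uy. auto.
      + intros Uy. split; auto. intros ->. auto. }
  destruct (choice (fun n y => K y /\ g n p y /\ y <> p)) as [x Hx].
  { intros n. apply HKp; auto. }
  exists p, x. split; [intros; apply Hx|]. intros U HU Up.
  (* [K] is covered by [U] and the open sets that miss some [g n p]; beyond the finitely many
     indices of a subcover, [x n] can only lie in [U]. *)
  destruct (HK (fun V => V = U \/ op V /\ exists n, forall y, V y -> ~ g n p y)) as [l [Hl Hcov]].
  - intros V [->|[HV _]]; auto.
  - intros y Ky. destruct (classic (U y)) as [Uy|Uy]; [exists U; auto|].
    assert (Hyp : y <> p) by (intros ->; auto).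
    destruct (HT1 y p Hyp) as [W [HW [Wy Wp]]].
    destruct (gstr y W HW Wy) as [n [N [HN [Ny HN']]]].
    exists N. split; auto. right. split; auto. exists n. intros z Nz Gz. apply Wp; eauto.
  - assert (exists M, forall V, In V l -> V = U \/ forall n y, (M <= n)%nat -> V y -> ~ g n p y)
      as [M HM].
    { clear Hcov. induction l as [|V l IH]; [exists O; simpl; tauto|].
      destruct IH as [M HM]; [intros; apply Hl; now right|].
      destruct (Hl V) as [->|[_ [m Hm]]]; [now left| |].
      - exists M. intros V' [<-|H]; auto.
      - exists (Nat.max M m). intros V' [<-|H].
        + right. intros n y Hn Vy Gy. apply (Hm y Vy), (gdec m n); auto; lia.
        + destruct (HM V' H) as [|H']; auto. right. intros n y Hn. apply H'. lia. }
    exists M. intros n Hn. destruct (Hx n) as [Kx [Gx _]].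
    destruct (Hcov (x n) Kx) as [V [HV Vx]].
    destruct (HM V HV) as [->|H]; auto. exfalso. apply (H n (x n)); auto.
Qed.

End RealFunctions.
Arguments cont {T} op u.

(** * The affine representation *)

(** A pair [p] stands for the affine map [t |-> fst p * t + snd p], and the product for
    composition. *)
Definition aff_mul (p q : R * R) : R * R := (fst p * fst q, fst p * snd q + snd p).
Definition aff_inv (p : R * R) : R * R := (/ fst p, - (snd p / fst p)).

Lemma aff_mul_assoc p q r : aff_mul (aff_mul p q) r = aff_mul p (aff_mul q r).
Proof. unfold aff_mul; simpl. f_equal; ring. Qed.

Lemma aff_mul_inv_l p z : 0 < fst p -> aff_mul (aff_inv p) (aff_mul p z) = z.
Proof. destruct z. unfold aff_mul, aff_inv; simpl. intros. f_equal; field; lra. Qed.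

Lemma aff_mul_inv_r p z : 0 < fst p -> aff_mul p (aff_mul (aff_inv p) z) = z.
Proof. destruct z. unfold aff_mul, aff_inv; simpl. intros. f_equal; field; lra. Qed.

Lemma aff_div_continuous (p q : R * R) : 0 < fst q ->
  continuous (fun pq : (R * R) * (R * R) => aff_mul (fst pq) (aff_inv (snd pq))) (p, q).
Proof.
  intros Hq.
  assert (C1 : continuous (fun z : (R * R) * (R * R) => fst (fst z)) (p, q))
    by (apply continuous_comp; apply continuous_fst).
  assert (C2 : continuous (fun z : (R * R) * (R * R) => snd (fst z)) (p, q))
    by (apply continuous_comp; [apply continuous_fst|apply continuous_snd]).
  assert (C3 : continuous (fun z : (R * R) * (R * R) => fst (snd z)) (p, q))
    by (apply continuous_comp; [apply continuous_snd|apply continuous_fst]).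
  assert (C4 : continuous (fun z : (R * R) * (R * R) => snd (snd z)) (p, q))
    by (apply continuous_comp; apply continuous_snd).
  assert (C5 : continuous (fun z : (R * R) * (R * R) => / fst (snd z)) (p, q))
    by (apply (continuous_comp (fun z : (R * R) * (R * R) => fst (snd z)) Rinv);
      [exact C3|apply continuous_Rinv; simpl; lra]).
  assert (D1 : continuous (fun z : (R * R) * (R * R) => fst (fst z) * / fst (snd z)) (p, q))
    by (apply (continuous_mult (K := R_AbsRing)); auto).
  assert (D2 : continuous (fun z : (R * R) * (R * R) =>
    fst (fst z) * - (snd (snd z) * / fst (snd z)) + snd (fst z)) (p, q)).
  { apply (continuous_plus (V := R_NormedModule)); auto.
    apply (continuous_mult (K := R_AbsRing)); auto.
    apply (continuous_opp (V := R_NormedModule)).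
    apply (continuous_mult (K := R_AbsRing)); auto. }
  intros Q [eps HQ].
  assert (E1 := D1 _ (locally_ball _ eps)). assert (E2 := D2 _ (locally_ball _ eps)).
  unfold filtermap in *. generalize (filter_and _ _ E1 E2). apply filter_imp.
  intros z [B1 B2]. apply HQ. split; [exact B1|exact B2].
Qed.

(* A pair of functions (a, b) with a > 0 sends x to the affine map t |-> a x * t + b x. *)
Section AffineRepresentation.
Context {X : Type}.
Variables a b : X -> R.
Hypothesis a_pos : forall x, 0 < a x.

Definition aff_letter (l : letter X) : R * R :=
  if snd l then (a (fst l), b (fst l)) else aff_inv (a (fst l), b (fst l)).

Definition aff_word (w : list (letter X)) : R * R :=
  fold_right (fun l z => aff_mul (aff_letter l) z) (1, 0) w.

Definition aff (g : FA X) : R * R := aff_word (word g).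

Lemma aff_word_app u v : aff_word (u ++ v) = aff_mul (aff_word u) (aff_word v).
Proof.
  induction u as [|l u IH]; simpl.
  - destruct (aff_word v). unfold aff_mul; simpl. f_equal; ring.
  - now rewrite IH, aff_mul_assoc.
Qed.

Lemma aff_letter_inv l z : aff_mul (aff_letter l) (aff_mul (aff_letter (letter_inv l)) z) = z.
Proof.
  destruct l as [x []]; unfold aff_letter; simpl; [apply aff_mul_inv_r|apply aff_mul_inv_l];
    apply a_pos.
Qed.

Lemma aff_word_push l w : aff_word (push l w) = aff_mul (aff_letter l) (aff_word w).
Proof.
  destruct w as [|m w]; auto.
  destruct (push_cases l m w) as [[-> ->]|[_ ->]]; auto.
  simpl. now rewrite aff_letter_inv.
Qed.

Lemma aff_word_reduce w : aff_word (reduce w) = aff_word w.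
Proof. induction w as [|l w IH]; auto. simpl. now rewrite aff_word_push, IH. Qed.

Lemma aff_FA_of w : aff (FA_of w) = aff_word w.
Proof. apply aff_word_reduce. Qed.

Lemma aff_word_pos w : 0 < fst (aff_word w).
Proof.
  induction w as [|[x c] w IH]; simpl; [lra|]. apply Rmult_lt_0_compat; auto.
  specialize (a_pos x). unfold aff_letter; destruct c; simpl; auto. now apply Rinv_0_lt_compat.
Qed.

Lemma aff_word_inv_mul w z : aff_mul (aff_word w) (aff_mul (aff_word (word_inv w)) z) = z.
Proof.
  revert z. induction w as [|l w IH]; intros z.
  - destruct z. unfold aff_mul; simpl. f_equal; ring.
  - unfold word_inv. simpl. fold (word_inv w). rewrite aff_word_app, !aff_mul_assoc, IH.
    simpl. rewrite aff_mul_assoc, aff_letter_inv. destruct z; unfold aff_mul; simpl; f_equal; ring.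
Qed.

Lemma aff_div g h : aff (FA_mul g (FA_inv h)) = aff_mul (aff g) (aff_inv (aff h)).
Proof.
  rewrite <- (FA_of_word g), <- (FA_of_word h), FA_div, !aff_FA_of, aff_word_app. f_equal.
  rewrite <- (aff_mul_inv_l (aff_word (word h)) (aff_word (word_inv (word h)))) by apply aff_word_pos.
  pose proof (aff_word_inv_mul (word h) (1, 0)) as H.
  assert (E : forall p, aff_mul p (1, 0) = p)
    by (intros [p q]; unfold aff_mul; simpl; f_equal; ring).
  rewrite E in H. now rewrite H, E.
Qed.

(** The initial topology of [aff], pulled back from the plane. It is a group topology because [aff]
    is a homomorphism into the affine maps of positive slope. *)
Definition aff_top (O : FA X -> Prop) : Prop :=
  forall g, O g -> locally (aff g) (fun p => forall h, aff h = p -> O h).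

Lemma aff_top_locally (g : FA X) (Q : R * R -> Prop) :
  locally (aff g) Q -> exists U, aff_top U /\ U g /\ forall h, U h -> Q (aff h).
Proof.
  intros H. exists (fun h => locally (aff h) Q). split; [|split; auto].
  - intros h Hh. apply locally_locally in Hh. revert Hh. apply filter_imp. now intros p Hp k ->.
  - intros h. apply locally_singleton.
Qed.

Lemma aff_top_is_group_topology : is_group_topology aff_top.
Proof.
  split; [split; [|split]|].
  - intros g _. now apply filter_forall.
  - intros U V HU HV g [Ug Vg]. generalize (filter_and _ _ (HU g Ug) (HV g Vg)).
    apply filter_imp. intros p [H1 H2] h Hh. auto.
  - intros F HF g [U [FU Ug]]. generalize (HF U FU g Ug). apply filter_imp. eauto.
  - intros g h O HO Ogh. apply HO in Ogh. rewrite aff_div in Ogh.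
    destruct (aff_div_continuous (aff g) (aff h) (aff_word_pos _) _ Ogh) as [eps Heps].
    destruct (aff_top_locally g _ (locally_ball (aff g) eps)) as [U [HU [Ug HU']]].
    destruct (aff_top_locally h _ (locally_ball (aff h) eps)) as [V [HV [Vh HV']]].
    exists U, V. split; [auto|split; [auto|split; [auto|split; [auto|]]]].
    intros g' h' Ug' Vh'. apply (Heps (aff g', aff h')).
    + split; [now apply HU'|now apply HV'].
    + apply aff_div.
Qed.

Lemma aff_top_eta (opX : (X -> Prop) -> Prop) : is_topology opX -> cont opX a -> cont opX b ->
  continuous_into opX aff_top (eta (X := X)).
Proof.
  intros hX Ha Hb O HO. apply (open_local hX). intros x Ox.
  assert (E : forall y, aff (eta y) = (a y, b y))
    by (intros y; unfold aff, aff_mul; simpl; unfold aff_mul, aff_letter; simpl; f_equal; ring).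
  destruct (HO _ Ox) as [eps Heps]. rewrite E in Heps.
  pose proof (cond_pos eps) as He.
  exists (fun y => (a y < a x + eps /\ a x - eps < a y) /\ (b y < b x + eps /\ b x - eps < b y)).
  split; [|split].
  - apply (open_inter hX); apply (open_inter hX); [apply Ha|apply Ha|apply Hb|apply Hb].
  - repeat split; lra.
  - intros y [[H1 H2] [H3 H4]]. apply (Heps (a y, b y)); auto.
    split; simpl; apply Rabs_lt_between'; lra.
Qed.

End AffineRepresentation.

(** * Failure of countable tightness *)

Section NotTight.
Context {X : Type} {opX : (X -> Prop) -> Prop} {g : nat -> X -> X -> Prop}.
Hypothesis hX : is_topology opX.
Hypothesis hg : stratifying opX g.

Definition conj_word (d x p : X) : list (letter X) :=
  [(d, true); (x, true); (p, false); (d, false)].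

Lemma word_inv_conj d x p : word_inv (conj_word d x p) = conj_word d p x.
Proof. reflexivity. Qed.

Lemma conj_word_trivial d p : FA_of (conj_word d p p) = FA_of [].
Proof.
  apply FA_ext.
  change (push (d, true) (push (p, true) (push (letter_inv (p, true)) (push (d, false) []))) = []).
  rewrite push_letter_inv by exact (reduced_single _).
  apply (push_letter_inv (d, true) []). exact I.
Qed.

Lemma eventually_in_box bs (ls : list (nat -> letter X)) w :
  open_box opX bs -> in_box bs w ->
  Forall2 (fun l a => (forall n, snd (l n) = snd a) /\
    forall U, opX U -> U (fst a) -> exists N, forall n, (N <= n)%nat -> U (fst (l n))) ls w ->
  exists N, forall n, (N <= n)%nat -> in_box bs (map (fun l => l n) ls).
Proof.
  intros Ob Bw Hls. revert bs Ob Bw.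
  induction Hls as [|l a ls w [H1 H2] Hls IH]; intros bs Ob Bw; inversion Bw; subst.
  - exists O. intros. constructor.
  - inversion Ob; subst. destruct (IH l0) as [N HN]; auto.
    destruct (H2 (fst x)) as [M HM]; [auto|tauto|].
    exists (Nat.max M N). intros n Hn. constructor.
    + split; [apply HM; lia|]. rewrite H1. tauto.
    + apply HN. lia.
Qed.

(** Letter by letter, both words converge to [conj_word d p p], which reduces to the empty word, and
    [FA_of] is continuous there. *)
Lemma conj_word_converges (p : X) (x : nat -> X) (tau : (FA X -> Prop) -> Prop) d O :
  (forall U, opX U -> U p -> exists N, forall n, (N <= n)%nat -> U (x n)) ->
  is_group_topology tau -> continuous_into opX tau (eta (X := X)) ->
  tau O -> O (FA_of []) ->
  exists N, forall n, (N <= n)%nat ->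
    O (FA_of (conj_word d (x n) p)) /\ O (FA_of (conj_word d p (x n))).
Proof.
  intros Hx Ht He HO Oe. rewrite <- (conj_word_trivial d p) in Oe.
  destruct (continuous_FA_of opX tau Ht He O HO _ Oe) as [bs [Ob [Bw Hbs]]].
  destruct (eventually_in_box bs [fun _ => (d, true); fun n => (x n, true);
    fun _ => (p, false); fun _ => (d, false)] _ Ob Bw) as [N1 HN1].
  { repeat constructor; auto; intros U _ HU; exists 0%nat; auto. }
  destruct (eventually_in_box bs [fun _ => (d, true); fun _ => (p, true);
    fun n => (x n, false); fun _ => (d, false)] _ Ob Bw) as [N2 HN2].
  { repeat constructor; auto; intros U _ HU; exists 0%nat; auto. }
  exists (Nat.max N1 N2). intros n Hn. split; apply Hbs; [apply HN1|apply HN2]; lia.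
Qed.

Lemma F8_not_tight (p : X) (x : nat -> X) (D : X -> Prop) :
  (forall n, exists U, opX U /\ U (x n) /\ ~ U p) ->
  (forall U, opX U -> U p -> exists N, forall n, (N <= n)%nat -> U (x n)) ->
  ~ cnt D ->
  (forall y, exists V, opX V /\ V y /\ forall r s, D r -> D s -> V r -> V s -> r = s) ->
  ~ countable_tightness_on (free_top opX) (Fn (X := X) 8).
Proof.
  intros Hxp Hx HD Hdisc Htight.
  pose proof (free_top_is_group_topology opX) as Hft.
  pose proof (free_top_eta opX hX) as Heta.
  pose proof hg as [gop [grefl [gdec gstr]]].
  (* Prepares for [a = 1] near [p]: [W] contains at most one point of [D], to be discarded, and
     [g n0 d] misses [N0] for every [d] outside [W]. *)
  destruct (Hdisc p) as [W [HW [Wp HWD]]].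
  destruct (gstr p W HW Wp) as [n0 [N0 [HN0 [Np HN0']]]].
  assert (exists y : nat -> X, (forall n, exists U, opX U /\ U (y n) /\ ~ U p) /\
    (forall U, opX U -> U p -> exists N, forall n, (N <= n)%nat -> U (y n)) /\
    forall n, N0 (y n)) as [y [Hyp [Hy HyN]]].
  { destruct (Hx N0 HN0 Np) as [M HM]. exists (fun n => x (M + n)%nat).
    split; [auto|split].
    - intros U HU Up. destruct (Hx U HU Up) as [N HN]. exists N. intros n Hn. apply HN. lia.
    - intros n. apply HM. lia. }
  clear x Hxp Hx. rename y into x, Hyp into Hxp, Hy into Hx, HyN into HxN.
  set (R0 := fun d => D d /\ ~ W d).
  assert (HR0 : ~ cnt R0).
  { intros H. apply HD. apply cnt_sub with (P := fun d => R0 d \/ (D d /\ W d)).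
    - intros d Dd. unfold R0. destruct (classic (W d)); tauto.
    - apply cnt_or; auto. exists (fun _ => O). intros r s [Dr Wr] [Ds Ws] _. auto. }
  destruct (uncountable_coloring R0 HR0) as [e He].
  set (F := fun d1 d2 => FA_of (conj_word d1 (x (e d1 d2)) p ++ conj_word d2 (x (e d1 d2)) p)).
  destruct (Htight (fun z => exists d1 d2, R0 d1 /\ R0 d2 /\ z = F d1 d2) (FA_of []))
    as [B [HBA [HB HBcl]]].
  - intros z [d1 [d2 [_ [_ ->]]]].
    assert (Hlen : forall w : list (letter X), (length (reduce w) <= length w)%nat).
    { induction w as [|l w IH]; auto. simpl. destruct (reduce w) as [|m v]; simpl in *; [lia|].
      destruct excluded_middle_informative; simpl; lia. }
    exact (Hlen _).
  - unfold Fn; simpl; lia.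
  - intros O HO Oe.
    assert (Oe' : O (FA_mul (FA_of []) (FA_inv (FA_of [])))).
    { now rewrite FA_div. }
    destruct Hft as [Htop Hdiv].
    destruct (Hdiv _ _ O HO Oe') as [U [V [HU [HV [Ue [Ve H]]]]]].
    (* [f d] is a stage from which the conjugate by [d] lies in [U] and its inverse in [V]; the
       colouring yields a pair for which the stage [e d1 d2] is late enough for both. *)
    destruct (choice (fun d N => forall n, (N <= n)%nat ->
      U (FA_of (conj_word d (x n) p)) /\ V (FA_of (conj_word d p (x n))))) as [f Hf].
    { intros d.
      destruct (conj_word_converges p x (free_top opX) d (fun z => U z /\ V z) Hx) as [N HN];
        [split; auto|auto|now apply Htop|auto|].
      exists N. intros n Hn. split; now apply HN. }
    destruct (He f) as [d1 [d2 [R1 [R2 [H1 H2]]]]].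
    exists (F d1 d2). split; [|exists d1, d2; auto].
    unfold F. rewrite <- (word_inv_conj d2 p), <- FA_div. apply H; apply Hf; auto.
  - destruct (positive_on_sequence hX hg p x Hxp) as [b [Hb [bp bx]]].
    apply countable_cnt in HB.
    destruct (choice (fun z dd => B z -> R0 (fst dd) /\ R0 (snd dd) /\ z = F (fst dd) (snd dd)))
      as [sp Hsp].
    { intros z. destruct (classic (B z)) as [Bz|Bz]; [|exists (p, p); tauto].
      destruct (HBA z Bz) as [d1 [d2 Hd]]. exists (d1, d2). auto. }
    set (D' := fun d => (exists z, B z /\ fst (sp z) = d) \/ (exists z, B z /\ snd (sp z) = d)).
    assert (HD' : cnt D').
    { apply cnt_or; [apply (cnt_image (fun z => fst (sp z)))|apply (cnt_image (fun z => snd (sp z)))];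
        auto. }
    assert (HD'R : forall d, D' d -> R0 d) by (intros d [[z [Bz <-]]|[z [Bz <-]]]; now apply Hsp).
    destruct HD' as [h Hh].
    set (G := fun d d' => Rmax (/ b (x (e d d'))) (/ b (x (e d' d)))).
    (* Bounding [G d d'] over the finitely many [d'] in [D'] with [h d'] at most [h d] is enough,
       since every pair has a letter with the larger [h]. *)
    destruct (choice (fun d L => forall d', D' d' -> (h d' <= h d)%nat -> G d d' <= L)) as [lam Hlam].
    { intros d. generalize (h d). intros n. induction n as [|n [L HL]].
      - destruct (classic (exists d', D' d' /\ h d' = O)) as [[d0 [H0 E0]]|H0].
        + exists (G d d0). intros d' Dd' Hd'. replace d' with d0; [apply Rle_refl|].
          apply Hh; auto. lia.
        + exists 0. intros d' Dd' Hd'. exfalso. apply H0. exists d'. split; auto. lia.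
      - destruct (classic (exists d', D' d' /\ h d' = S n)) as [[d0 [H0 E0]]|H0].
        + exists (Rmax L (G d d0)). intros d' Dd' Hd'. destruct (Nat.eq_dec (h d') (S n)).
          * replace d' with d0; [apply Rmax_r|]. apply Hh; auto. lia.
          * apply Rle_trans with L; [|apply Rmax_l]. apply HL; auto. lia.
        + exists L. intros d' Dd' Hd'. apply HL; auto.
          destruct (Nat.eq_dec (h d') (S n)); [|lia]. exfalso; eauto. }
    destruct (large_on_discrete hX hg D' lam n0 N0) as [a [Ha [a1 [alam aN]]]].
    { exists h. auto. }
    { intros y. destruct (Hdisc y) as [V [HV [Vy HV']]]. exists V. repeat split; auto.
      intros r s Dr Ds. apply HV'; now apply HD'R. }
    { intros d y Dd Ny Gd. destruct (HD'R d Dd) as [_ Wd]. apply Wd. eauto. }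
    assert (a_pos : forall y, 0 < a y) by (intros y; specialize (a1 y); lra).
    destruct (aff_top_locally a b (FA_of []) _ (locally_ball _ (mkposreal 1 Rlt_0_1)))
      as [U [HU [Ue HUb]]].
    destruct (HBcl U) as [z [Uz Bz]]; auto.
    { apply free_top_in with (aff_top a b); auto.
      - now apply aff_top_is_group_topology.
      - now apply aff_top_eta. }
    apply HUb in Uz. destruct Uz as [_ Uz].
    destruct (Hsp z Bz) as [_ [_ Ez]].
    assert (D1 : D' (fst (sp z))) by (left; eauto).
    assert (D2 : D' (snd (sp z))) by (right; eauto).
    revert Ez D1 D2. generalize (fst (sp z)) (snd (sp z)). intros d1 d2 -> D1 D2.
    (* [p] acts as the identity and [x n] as translation by [b (x n)]. Conjugation by [d] scales
       this by [a d], so the word translates by [(a d1 + a d2) * t]. *)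
    unfold F in Uz. rewrite !aff_FA_of in Uz by exact a_pos.
    unfold conj_word, aff_word, aff_letter, aff_mul, aff_inv in Uz. simpl in Uz.
    rewrite bp, (aN p Np), (aN _ (HxN _)) in Uz.
    set (t := b (x (e d1 d2))) in *.
    assert (Ht : 0 < t) by apply bx.
    match type of Uz with ball 0 1 ?s => replace s with ((a d1 + a d2) * t) in Uz end.
    2: { pose proof (a_pos d1). pose proof (a_pos d2). field. lra. }
    assert (Hbig : / t <= a d1 \/ / t <= a d2).
    { destruct (Nat.le_ge_cases (h d2) (h d1)) as [L|L].
      - left. apply Rle_trans with (lam d1); auto. apply Rle_trans with (G d1 d2); auto.
        apply Rmax_l.
      - right. apply Rle_trans with (lam d2); auto. apply Rle_trans with (G d2 d1); auto.
        apply Rmax_r. }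
    assert (1 <= (a d1 + a d2) * t).
    { replace 1 with (/ t * t) by (field; lra). apply Rmult_le_compat_r; [lra|].
      specialize (a_pos d1) as P1. specialize (a_pos d2) as P2. lra. }
    change (Rabs ((a d1 + a d2) * t - 0) < 1) in Uz. apply Rabs_def2 in Uz. lra.
Qed.

End NotTight.

Theorem theorem3p1 (X : Type) (opX : (X -> Prop) -> Prop)
  (hX : is_topology opX) (hstrat : stratifiable opX) (hk : k_space opX) :
  (countable_tightness_on (free_top opX) (Fn (X := X) 8) <->
   countable_tightness (free_top opX)) /\
  (countable_tightness (free_top opX) <-> separable opX \/ discrete opX).
Proof.
  destruct (stratifiable_stratifying opX hX hstrat) as [g hg].
  assert (H21 : countable_tightness (free_top opX) ->
    countable_tightness_on (free_top opX) (Fn (X := X) 8)).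
  { intros H A y _ _. apply H; auto. }
  assert (H32 : separable opX \/ discrete opX -> countable_tightness (free_top opX)).
  { intros [H|H]; [now apply separable_countable_tightness with g|].
    (* In the discrete topology [y] already lies in [A], so the singleton serves. *)
    intros A y _ _ Hy. exists (fun z => z = y). split; [|split].
    - intros z ->. destruct (Hy (fun z => z = y)) as [z [-> Az]]; auto.
      now apply free_top_discrete.
    - exists (fun _ => y). intros z ->. now exists O.
    - apply subset_closure. reflexivity. }
  assert (H13 : countable_tightness_on (free_top opX) (Fn (X := X) 8) ->
    separable opX \/ discrete opX).
  { intros H. destruct (classic (discrete opX)) as [Hd|Hd]; [now right|left].
    destruct (convergent_sequence hX hg (proj1 hstrat) hk Hd) as [p [x [Hxp Hx]]].
    destruct (separable_or_discrete hX hg (fun _ => True)) as [[D [HD [_ Hcl]]]|[D [HD [_ Hdisc]]]].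
    - exists D. split; auto. now apply (cnt_countable p).
    - exfalso. revert H. apply (F8_not_tight hX hg p x D); auto.
      intros n. destruct (proj1 hstrat (x n) p (Hxp n)) as [U HU]. eauto. }
  tauto.
Qed.
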